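(* Let $\mathcal{X}$ be a class of abelian groups with $\mathcal{EB}\subseteq\mathcal{X}\subseteq\mathcal{DF}$. Then $\mathcal{X}^s=\mathcal{EB}$; that is, a group $G$ has the property that it and all its epimorphic images lie in $\mathcal{X}$ if and only if $G$ is Extended Bassian. In particular $\mathcal{DF}^s=\mathcal{EB}$.
   Context: All groups are abelian; a class is closed under isomorphism. $\mathcal{DF}$: directly finite groups ($G$ is not isomorphic to a proper direct summand of itself, i.e., no $G=A\oplus C$ with $C\ne0$ and $A\cong G$). A group is Bassian if there is no nonzero subgroup $H\le G$ with an injective homomorphism $G\to G/H$. $\mathcal{EB}$: Extended Bassian groups, i.e. groups $B\oplus D$ with $B$ Bassian and $D=\bigoplus_{p\ \text{prime}}\mathbb{Z}(p^\infty)^{(n_p)}$, each $n_p$ finite. For a class $\mathcal{X}$, $\mathcal{X}^s=\{G\in\mathcal{X}:\text{every epimorphic image of }G\text{ is in }\mathcal{X}\}$. *)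

(* Defs.v *)
From HB Require Import structures.
From mathcomp Require Import all_boot all_order all_algebra.
Set Implicit Arguments. Unset Strict Implicit. Unset Printing Implicit Defensive.
Import GRing.Theory Num.Theory.
Local Open Scope ring_scope.

Definition gclass := zmodType -> Prop.

Definition giso (G H : zmodType) : Prop :=
  exists f : {additive G -> H}, bijective f.

Definition iso_closed (X : gclass) : Prop :=
  forall G H : zmodType, giso G H -> X G -> X H.

Definition subclass (X Y : gclass) : Prop := forall G, X G -> Y G.

(* Directly finite: there is no decomposition G = A (+) C (internal direct
   sum) with C <> 0 and A isomorphic to G.  We write A as the image of an
   injective endomorphism f (A = f(G) is then isomorphic to G, and every
   subgroup isomorphic to G arises this way). *)
Definition directly_finite (G : zmodType) : Prop :=
  ~ exists (f : {additive G -> G}) (C : G -> Prop),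
      injective f /\
      C 0 /\ (forall x y, C x -> C y -> C (x - y)) /\
      (exists c, C c /\ c <> 0) /\
      (forall g, exists a c, C c /\ g = f a + c) /\
      (forall a, C (f a) -> f a = 0).

(* Bassian: no nonzero subgroup H <= G with an injection G -> G/H.
   G/H is represented (up to isomorphism) by an epimorphism pi : G -> K
   with kernel H. *)
Definition bassian (G : zmodType) : Prop :=
  ~ exists (K : zmodType) (pi : {additive G -> K}) (h : {additive G -> K}),
      (forall k : K, exists g, pi g = k) /\
      (exists x : G, x <> 0 /\ pi x = 0) /\
      injective h.

(* Model of D = (+)_{p prime} Z(p^oo)^(n_p):
   it is P_n / Z_n where P_n is the group of finitely supported functions
   f : nat * nat -> rat, supported on slots (p, i) with p prime and i < n p,
   with f (p, i) in Z[1/p]; and Z_n is the subgroup of integer-valued ones. *)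
Definition Dsub (n : nat -> nat) (f : nat * nat -> rat) : Prop :=
  (forall p i, f (p, i) != 0 -> prime p /\ (i < n p)%N) /\
  (exists N : nat, forall p i, f (p, i) != 0 -> (p < N)%N) /\
  (forall p i, exists k : nat, exists z : int, (p ^ k)%:R * f (p, i) = z%:~R).

Definition int_valued (f : nat * nat -> rat) : Prop :=
  forall s, exists z : int, f s = z%:~R.

(* Extended Bassian: G is isomorphic to B (+) D with B Bassian and
   D = (+)_p Z(p^oo)^(n_p), each n_p finite.  The isomorphism
   B (+) P_n / Z_n ~= G is given by a homomorphism psi : B (+) P_n -> G
   which is onto and has kernel exactly 0 (+) Z_n. *)
Definition extended_bassian (G : zmodType) : Prop :=
  exists (B : zmodType) (n : nat -> nat) (psi : B -> (nat * nat -> rat) -> G),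
    bassian B /\
    (forall b1 b2 f1 f2, Dsub n f1 -> Dsub n f2 ->
        psi (b1 + b2) (fun s => f1 s + f2 s) = psi b1 f1 + psi b2 f2) /\
    (forall g, exists b f, Dsub n f /\ psi b f = g) /\
    (forall b f, Dsub n f -> psi b f = 0 -> b = 0 /\ int_valued f) /\
    (forall f, Dsub n f -> int_valued f -> psi 0 f = 0).

Definition sclass (X : gclass) : gclass := fun G =>
  X G /\ forall (K : zmodType) (f : {additive G -> K}),
          (forall k : K, exists g, f g = k) -> X K.

(* Main.v *)
Require Import Defs.
From HB Require Import structures.
From mathcomp Require Import all_boot all_order all_algebra finmap.
From mathcomp Require Import boolp classical_sets cardinality ring_quotient zify.
Set Implicit Arguments. Unset Strict Implicit. Unset Printing Implicit Defensive.
Import Order.TTheory GRing.Theory Num.Theory.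
Local Open Scope classical_set_scope.
Local Open Scope ring_scope.

(* The pivot is the class of groups of finite ranks: finite torsion-free rank
   and finite p-socle for every prime p.  It is closed under quotients, is
   contained in DF by a rank count, and a group in it splits off its maximal
   divisible torsion subgroup, leaving a complement with finite primary parts,
   which is Bassian.  Conversely, if some rank of G is infinite, G contains
   F = <y_0, y_1, ...>, a countable direct sum of cyclic groups, which maps onto
   E = C^(omega) with C one of Q, Z(p^oo), Z/p^n by a non-injective a, and embeds
   in E by some b; both extend to G because E sits in a divisible group.  Then E
   is a quotient of G that is not directly finite, so G is not in DF^s; and
   (b, pi) : G -> E (+) G/F is injective while (a, pi) is onto with kernel
   ker a|F <> 0, so G is not Bassian. *)

(** * Subgroups, quotients and extension of homomorphisms *)

(** The obstacle is to extend [a] and [b] to G while keeping their values in C^(omega), which is not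
    divisible when C = Z/p^n. So C^(omega) is realized as the [N]-torsion of the divisible group
    (Q/R)^(omega), and the extensions are made to vanish on [N G]. This asks F to meet [N G] only in
    0, which is why [obstructed] constrains all relations [comb y n c = g *+ N] and not only those
    with right-hand side 0. For C = Q or Z(p^oo) one takes [N = 0], and the constraint is plain
    independence. The case Z/p^n cannot be avoided: an infinite p-socle need not provide independent
    elements of unbounded order. If all the groups G[p] meet p^k G are infinite, there are
    independent [y_i] of order p^(i+1), and C = Z(p^oo). Otherwise, for the least n that makes G[p]
    meet p^n G finite, there are [y_i] of order p^n independent modulo p^n G, and C = Z/p^n with
    [N = p^n]. *)

Definition subgroup (G : zmodType) (H : set G) : Prop :=
  H 0 /\ forall x y, H x -> H y -> H (x - y).

(** The proof of [subgroup H] is an argument so that instance inference can recover closure from the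
    predicate itself. *)
Definition subgroup_pred (G : zmodType) (H : set G) (_ : subgroup H) : pred G :=
  fun x => `[< H x >].

Lemma subgroup_pred_closed (G : zmodType) (H : set G) (sH : subgroup H) :
  zmod_closed (subgroup_pred sH).
Proof.
split; first by apply/asboolP; case: sH.
by move=> x y /asboolP Hx /asboolP Hy; apply/asboolP; apply: (sH.2).
Qed.

HB.instance Definition _ (G : zmodType) (H : set G) (sH : subgroup H) :=
  GRing.isZmodClosed.Build G (subgroup_pred sH) (subgroup_pred_closed sH).

Definition subgroup_type (G : zmodType) (H : set G) (sH : subgroup H) :=
  {x : G | subgroup_pred sH x}.

HB.instance Definition _ (G : zmodType) (H : set G) (sH : subgroup H) :=
  SubChoice.on (subgroup_type sH).
HB.instance Definition _ (G : zmodType) (H : set G) (sH : subgroup H) :=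
  [SubChoice_isSubZmodule of subgroup_type sH by <:].

Lemma subgroup_zmod (G : zmodType) (H : set G) : subgroup H ->
  exists (K : zmodType) (i : {additive K -> G}),
    injective i /\ forall x, H x <-> exists k, i k = x.
Proof.
move=> sH; exists (subgroup_type sH), (val : {additive subgroup_type sH -> G}).
split; first exact: val_inj.
move=> x; split=> [Hx|[[y Hy] <-]]; last exact/asboolP.
have Hx' : subgroup_pred sH x by apply/asboolP.
by exists (exist _ x Hx').
Qed.

Lemma quotient_zmod (G : zmodType) (H : set G) : subgroup H ->
  exists (K : zmodType) (p : {additive G -> K}),
    (forall k, exists g, p g = k) /\ forall x, p x = 0 <-> H x.
Proof.
move=> sH; pose I := GRing.ZmodClosed.clone G (subgroup_pred sH) _.
exists (Quotient.quot I), (\pi_(Quotient.quot I) : {additive G -> _})%qT.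
split=> [k|x]; first by exists (repr k); exact: reprK.
have -> : (0 : Quotient.quot I) = \pi_(Quotient.quot I)%qT 0 by rewrite raddf0.
split=> [/eqP|Hx]; first by rewrite -Quotient.idealrBE subr0 => /asboolP.
by apply/eqP; rewrite -Quotient.idealrBE subr0; apply/asboolP.
Qed.

Lemma additive_of (G K : zmodType) (f : G -> K) :
  (forall x y, f (x + y) = f x + f y) -> exists g : {additive G -> K}, g =1 f.
Proof.
move=> fD.
have fB : zmod_morphism f.
  by move=> x y; apply: (addIr (f y)); rewrite -fD !addrNK.
pose fA : {additive G -> K} :=
  HB.pack f (GRing.isZmodMorphism.Build G K f fB).
by exists fA.
Qed.

Lemma subgroupN (G : zmodType) (H : set G) x : subgroup H -> H x -> H (- x).
Proof. by move=> [H0 HB] Hx; rewrite -sub0r; apply: HB. Qed.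

Lemma subgroupD (G : zmodType) (H : set G) x y :
  subgroup H -> H x -> H y -> H (x + y).
Proof. by move=> sH Hx Hy; rewrite -[y]opprK; apply: sH.2 => //; apply: subgroupN. Qed.

Lemma subgroupMz (G : zmodType) (H : set G) x (m : int) :
  subgroup H -> H x -> H (x *~ m).
Proof.
move=> sH Hx; have Hn n : H (x *+ n).
  elim: n => [|n IH]; first by rewrite mulr0n; exact: sH.1.
  by rewrite mulrS; apply: subgroupD.
case: m => n /=; first by rewrite -pmulrn; exact: Hn.
by rewrite NegzE mulrNz; apply: subgroupN => //; apply: Hn.
Qed.

Lemma factor (G K L : zmodType) (p : {additive G -> K}) (f : {additive G -> L}) :
  (forall k, exists g, p g = k) -> (forall x, p x = 0 -> f x = 0) ->
  exists h : {additive K -> L}, forall x, h (p x) = f x.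
Proof.
move=> /choice[s ps] kpf.
have e x y : p x = p y -> f x = f y.
  by move=> /eqP; rewrite -subr_eq0 -raddfB => /eqP/kpf/eqP; rewrite raddfB subr_eq0 => /eqP.
have [h hE] : exists h : {additive K -> L}, h =1 f \o s.
  by apply: additive_of => x y /=; rewrite -raddfD; apply: e; rewrite raddfD !ps.
by exists h => x; rewrite hE /=; apply: e.
Qed.

Definition divisible (E : zmodType) : Prop :=
  forall (n : nat) (x : E), (0 < n)%N -> exists y, y *+ n = x.

Lemma pair_mulz (G E : zmodType) (g : G) (e : E) (z : int) :
  (g, e) *~ z = (g *~ z, e *~ z).
Proof.
have pairMn n : (g, e) *+ n = (g *+ n, e *+ n).
  by elim: n => [|n IH]; rewrite ?mulr0n // !mulrS IH.
by case: z => n; rewrite ?NegzE ?mulrNz -!pmulrn pairMn.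
Qed.

(* [R] is the graph of a homomorphism defined on a subgroup of [G]. *)
Lemma divisible_extension (G E : zmodType) (R : set (G * E)) :
  divisible E -> subgroup R -> (forall e, R (0, e) -> e = 0) ->
  exists f : {additive G -> E}, forall g e, R (g, e) -> f g = e.
Proof.
move=> divE sR fR.
pose good (A : set (G * E)) := subgroup A /\ forall e, A (0, e) -> e = 0.
(* Asking goodness of the union with [R] makes the empty chain harmless: its union gives [R]
   itself. *)
have := @Zorn_bigcup _ (fun A => good (R `|` A)).
case.
  move=> F Fgood Ftot.
  have key x y : (R `|` \bigcup_(X in F) X) x -> (R `|` \bigcup_(X in F) X) y ->
      exists X, [/\ good (R `|` X), (R `|` X) x, (R `|` X) y &
                    R `|` X `<=` R `|` \bigcup_(X in F) X].
    have sub X : F X -> R `|` X `<=` R `|` \bigcup_(X in F) X.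
      by move=> FX z [Rz|Xz]; [left|right; exists X].
    move=> [Rx|[X FX Xx]] [Ry|[Y FY Yy]].
    - exists set0; rewrite setU0; split=> //; by [split|move=> z; left].
    - by exists Y; split; [exact: Fgood|left|right|exact: sub].
    - by exists X; split; [exact: Fgood|right|left|exact: sub].
    - have [XY|YX] := Ftot _ _ FX FY.
      + by exists Y; split; [exact: Fgood|right; apply: XY|right|exact: sub].
      + by exists X; split; [exact: Fgood|right|right; apply: YX|exact: sub].
  split; first split; first by left; exact: sR.1.
    by move=> x y /key/[apply] -[X [[[_ XB] _] Xx Xy]]; apply; apply: XB.
  by move=> e e0; have [X [[_ gX] Xe _ _]] := key _ _ e0 e0; exact: gX.
move=> A0 [[sA fA] Amax]; set A := R `|` A0 in sA fA Amax.
have A0A : A `<=` A0.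
  move=> x Ax; apply: contrapT => nA0x.
  apply: (Amax (A0 `|` [set x])).
    by rewrite properEneq; split;
      [apply/eqP => A0E; apply: nA0x; rewrite A0E; right | move=> z; left].
  rewrite setUA (_ : _ `|` _ = A) //; apply/seteqP; split=> z; last by left.
  by case=> // ->.
have tot g : exists e, A (g, e).
  apply: contrapT => ng.
  pose D := [set n | (0 < n)%N /\ exists e, A (g *+ n, e)].
  (* [e0] is the value to assign to [g]. If no positive multiple of [g] lies in the domain, 0 will
     do; otherwise the least such [n] divides all the others, and the value at [g *+ n] is divided
     by [n] in [E]. *)
  have [e0 e0P] : exists e0, forall (z : int) e, A (g *~ z, e) -> e = e0 *~ z.
    have fun0 z e e' : A (g *~ z, e) -> A (g *~ z, e') -> e = e'.
      move=> ze ze'; apply/eqP; rewrite -subr_eq0; apply/eqP/fA.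
      by rewrite -[0](subrr (g *~ z)); apply: (sA.2 (_, e) (_, e')).
    have mulA z e (w : int) : A (g *~ z, e) -> A (g *~ (z * w), e *~ w).
      by move=> /(subgroupMz w sA); rewrite pair_mulz mulrzA.
    have Dabs (z : int) e : z != 0 -> A (g *~ z, e) -> D `|z|%N.
      move=> z0 Aze; split; first by rewrite absz_gt0.
      exists (e *~ sgz z); rewrite pmulrn abszEsg mulrC; exact: mulA.
    have [exD|nD] := pselect (exists n, D n); last first.
      exists 0 => z e Aze; rewrite mul0rz.
      have [z0|z0] := eqVneq z 0; last by case: nD; exists `|z|%N; apply: Dabs Aze.
      by apply: fA; rewrite -[0](mulr0z g) -z0.
    have exD' : exists n, `[< D n >] by case: exD => n Dn; exists n; apply/asboolP.
    case: (ex_minnP exD') => n /asboolP[n0 [en An]] nmin.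
    have [e0 e0n] := divE n en n0; exists e0 => z e Aze.
    have zE := divz_eq z n.
    have AqE : A (g *~ (n%:Z * (z %/ n)%Z), en *~ (z %/ n)%Z) by apply: mulA; rewrite -pmulrn.
    have Ar : A (g *~ (z %% n)%Z, e - en *~ (z %/ n)%Z).
      have -> : (z %% n)%Z = z - n%:Z * (z %/ n)%Z by rewrite {2}zE mulrC (addrC (_ * _)) addrK.
      rewrite mulrzBr; exact: (sA.2 _ _ Aze AqE).
    have r0 : (z %% n)%Z = 0.
      apply/eqP; apply: contraT => rn0.
      have /nmin : `[< D `|(z %% n)%Z|%N >] by apply/asboolP; apply: Dabs rn0 Ar.
      rewrite leqNgt -ltz_nat abszE ger0_norm ?ltz_pmod ?modz_ge0 -?lt0n //.
    apply: (fun0 z) => //.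
    by rewrite {2}zE r0 addr0 [_ * n%:Z]mulrC mulrzA -[e0 *~ n]pmulrn e0n {1}zE r0 addr0 mulrC.
  pose B := [set x | exists (a : G * E) (z : int), A a /\ x = a + (g, e0) *~ z].
  have AB : A `<=` B by move=> x Ax; exists x, 0; rewrite mulr0z addr0.
  have RB : R `|` B = B.
    by apply/seteqP; split=> x; [case=> // Rx; apply: AB; left|right].
  apply: (Amax B).
    rewrite properEneq; split; last by move=> x A0x; apply: AB; right.
    apply/eqP => A0E; apply: ng; exists e0; right; rewrite A0E.
    by exists 0, 1; rewrite add0r mulr1z; split=> //; exact: sA.1.
  rewrite /good RB; split; first split.
  - exact: (AB _ sA.1).
  - move=> _ _ [a [z [Aa ->]]] [b [w [Ab ->]]].
    exists (a - b), (z - w); split; first exact: sA.2.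
    by rewrite mulrzBr opprD addrACA.
  - move=> e [[a1 a2] [z [Aa [ga ->]]]] /=.
    have a2E : a2 = e0 *~ (- z).
      apply: e0P; rewrite mulrNz (_ : - _ = a1) //.
      by apply/esym/eqP; rewrite -addr_eq0 ga; apply/eqP; rewrite /= ?pair_mulz.
    by rewrite a2E pair_mulz mulrNz addNr.
have [f fP] := choice tot.
have Auniq g e e' : A (g, e) -> A (g, e') -> e = e'.
  move=> ge ge'; apply/eqP; rewrite -subr_eq0; apply/eqP/fA.
  by rewrite -[0](subrr g); apply: (sA.2 (g, e) (g, e')).
have [h hE] := @additive_of G E f (fun x y => Auniq _ _ _ (fP (x + y))
   (subgroupD (x := (x, f x)) (y := (y, f y)) sA (fP x) (fP y))).
by exists h => g e Rge; rewrite hE; apply: Auniq (fP g) _; left.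
Qed.

(** * Obstructions to finite rank *)

Definition comb (G : zmodType) (y : nat -> G) (n : nat) (c : nat -> int) : G :=
  \sum_(i < n) y i *~ c i.

Lemma comb_pad (G : zmodType) (y : nat -> G) n m c : (n <= m)%N ->
  comb y m (fun i => if (i < n)%N then c i else 0) = comb y n c.
Proof.
move=> nm; rewrite /comb (big_ord_widen _ (fun i => y i *~ c i) nm) [RHS]big_mkcond /=.
by apply: eq_bigr => i _; case: ifP => // _; rewrite mulr0z.
Qed.

Lemma combB (G : zmodType) (y : nat -> G) n c d :
  comb y n (fun i => c i - d i) = comb y n c - comb y n d.
Proof. by rewrite /comb -sumrB; apply: eq_bigr => i _; rewrite mulrzBr. Qed.

Lemma comb_mulz (G : zmodType) (y : nat -> G) n c (z : int) :
  comb y n (fun i => c i * z) = comb y n c *~ z.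
Proof. by rewrite /comb mulrz_suml; apply: eq_bigr => i _; rewrite mulrzA. Qed.

Lemma raddf_comb (G E : zmodType) (f : {additive G -> E}) (y : nat -> G) n c :
  f (comb y n c) = comb (f \o y) n c.
Proof. by rewrite raddf_sum; apply: eq_bigr => i _; rewrite raddfMz. Qed.

Lemma eq_comb (G : zmodType) (y z : nat -> G) n c d :
  (forall i, (i < n)%N -> y i *~ c i = z i *~ d i) -> comb y n c = comb z n d.
Proof. by move=> e; apply: eq_bigr => i _; apply: e. Qed.

Lemma comb_delta (G : zmodType) (y : nat -> G) n i :
  (i < n)%N -> comb y n (fun j => (j == i)%:Z) = y i.
Proof.
move=> lt_in; rewrite /comb (bigD1 (Ordinal lt_in)) //= eqxx mulr1z big1 ?addr0 //.
by move=> j /negPf; rewrite -val_eqE /= => ->.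
Qed.

Definition spanned (G : zmodType) (y : nat -> G) : set G :=
  [set g | exists n c, g = comb y n c].

Lemma spanned_subgroup (G : zmodType) (y : nat -> G) : subgroup (spanned y).
Proof.
split; first by exists 0, (fun=> 0); rewrite /comb big_ord0.
move=> _ _ [n [c ->]] [m [d ->]]; exists (maxn n m).
by exists (fun i => (if (i < n)%N then c i else 0) - (if (i < m)%N then d i else 0));
  rewrite combB !comb_pad ?leq_maxl ?leq_maxr.
Qed.

Lemma mem_spanned (G : zmodType) (y : nat -> G) i : spanned y (y i).
Proof. by exists i.+1, (fun j => (j == i)%:Z); rewrite comb_delta. Qed.

(** The map [y i |-> a i] is first extended by 0 on [N G]; the hypothesis says that the two
    prescriptions agree where they overlap. Vanishing on [N G] is what keeps the values in the
    [N]-torsion of [E]. *)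
Lemma family_extension (G E : zmodType) (N : nat) (y : nat -> G) (a : nat -> E) :
  divisible E ->
  (forall n c g, comb y n c = g *+ N -> comb a n c = 0) ->
  exists f : {additive G -> E},
    (forall i, f (y i) = a i) /\ forall g, f g *+ N = 0.
Proof.
move=> divE ya.
pose R := [set x : G * E | exists n c g, x = (comb y n c + g *+ N, comb a n c)].
have [||f fR] := @divisible_extension G E R divE.
- split; first by exists 0, (fun=> 0), 0; rewrite mul0rn addr0 /comb !big_ord0.
  move=> _ _ [n [c [g ->]]] [m [d [h ->]]].
  pose cd i := (if (i < n)%N then c i else 0) - (if (i < m)%N then d i else 0).
  exists (maxn n m), cd, (g - h).
  rewrite !combB !comb_pad ?leq_maxl ?leq_maxr //.
  by congr pair; rewrite /= mulrnBl opprD addrACA.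
- move=> e [n [c [g [y0 ->]]]]; apply: (ya n c (- g)).
  by apply/eqP; rewrite mulNrn -addr_eq0 -y0.
- exists f; split=> [i|g].
    apply: fR; exists i.+1, (fun j => (j == i)%:Z), 0.
    by rewrite !comb_delta // mul0rn addr0.
  rewrite -raddfMn; apply: fR; exists 0, (fun=> 0), g.
  by rewrite /comb !big_ord0 add0r.
Qed.

(** Polynomials serve as Q^(omega), with one coordinate for each power of ['X]. The quotient by this
    subgroup is (Q/R)^(omega), and multiplication by ['X] is its shift. *)
Definition rat_poly_over (R : set rat) : set {poly rat} :=
  [set P | forall i, R P`_i].

Lemma rat_poly_over_subgroup (R : set rat) :
  subgroup R -> subgroup (rat_poly_over R).
Proof.
move=> sR; split=> [i|P Q RP RQ i]; first by rewrite coef0; exact: sR.1.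
by rewrite coefB; apply: sR.2.
Qed.

(* An infinite family [y] witnessing infinite rank: [R] is [0] or the
   localization Z_(p), and [u] generates the [N]-torsion of Q/R, i.e. Q,
   Z(p^oo) or Z/p^n. *)
Definition obstructed (G : zmodType) : Prop :=
  exists (N : nat) (R : set rat) (u : nat -> rat) (y : nat -> G),
    [/\ subgroup R, ~ R (u 0) /\ (forall k, R (u k *+ N)),
        forall q, R (q *+ N) -> exists k (z : int), R (q - u k *~ z),
        forall n c g, comb y n c = g *+ N ->
          forall i k, (k <= i < n)%N -> R (u k *~ c i)
      & forall i (c : int), R (u i *~ c) -> y i *~ c = 0].

(* Writing [i = 2 ^ j * (2 * k + 1)] enumerates the pairs [(j, k)], with [k <= i]. *)
Lemma odd_part_code j k (i := (2 ^ j * k.*2.+1)%N) :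
  (0 < i)%N /\ logn 2 i = j /\ (i %/ 2 ^ logn 2 i)./2 = k.
Proof.
have i0 : (0 < i)%N by rewrite muln_gt0 expn_gt0.
have lj : logn 2 i = j.
  rewrite lognM ?expn_gt0 // pfactorK // [X in (_ + X)%N](_ : _ = 0%N) ?addn0 //.
  by apply/eqP; rewrite -leqn0 leqNgt logn_gt0 mem_primes /= dvdn2 /= odd_double.
by rewrite lj mulKn ?expn_gt0 //= uphalf_double.
Qed.

Lemma obstructed_maps (G : zmodType) : obstructed G ->
  exists (N : nat) (R : set rat) (r : rat) (E : zmodType)
         (p : {additive {poly rat} -> E}) (F : set G) (a b : {additive G -> E}),
    [/\ subgroup R, ~ R r /\ R (r *+ N),
        (forall e, exists P, p P = e) /\ (forall P, p P = 0 <-> rat_poly_over R P),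
        (forall g, a g *+ N = 0) /\ (forall g, b g *+ N = 0)
      & [/\ subgroup F, forall e, e *+ N = 0 -> exists2 x, F x & a x = e,
            forall x, F x -> b x = 0 -> x = 0
          & exists x, [/\ F x, x <> 0 & a x = 0]]].
Proof.
move=> [N [R [u [y [sR [u0 uN] gen yR Ry]]]]].
have [E [p [psurj pker]]] := quotient_zmod (rat_poly_over_subgroup sR).
have divE : divisible E.
  move=> n x n0; have [P <-] := psurj x; exists (p (n%:R^-1 *: P)).
  by rewrite -raddfMn scalerMnl -mulr_natr mulVf ?scale1r // pnatr_eq0 -lt0n.
pose mono k j := p (u k *: 'X^j).
have mono0 k j (c : int) : R (u k *~ c) -> mono k j *~ c = 0.
  move=> Rc; rewrite -raddfMz pker => i.
  by rewrite scalerMzl coefZ coefXn; case: (i == j); rewrite ?mulr1 ?mulr0 //; exact: sR.1.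
(* Through the code i = 2^j (2k+1), every [u k] in every coordinate [j] is a value, so [a] covers
   the [N]-torsion. Index 0 is left over by the code and goes to 0: [y 0] is the nonzero kernel
   element. The bound k <= i is what lets [yR] apply. *)
pose av i := if i == 0%N then 0 else mono (i %/ 2 ^ logn 2 i)./2 (logn 2 i).
have [|a [aE aN]] := @family_extension G E N y av divE.
  move=> n c g /yR cR; apply: big1 => -[i lt_in] _ /=; rewrite /av.
  case: ifP => _; first by rewrite mul0rz.
  apply: mono0; apply: cR; rewrite lt_in andbT.
  rewrite (leq_trans (half_leq (leq_div _ _))) // -{2}[i]odd_double_half.
  by rewrite -addnn addnA leq_addl.
(* Each [y i] gets a coordinate of its own, hence injectivity on F. *)
have [|b [bE bN]] := @family_extension G E N y (fun i => mono i i) divE.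
  move=> n c g /yR cR; apply: big1 => -[i lt_in] _ /=.
  by apply: mono0; apply: cR; rewrite leqnn.
exists N, R, (u 0), E, p, (spanned y), a, b.
split; [by []|by split; [|exact: uN]|by []|by []|split].
- exact: spanned_subgroup.
- move=> e; have [P <-] := psurj e; rewrite -raddfMn pker => PN.
  have /choice[k /choice[z kz]] j : exists k, exists z : int, R (P`_j - u k *~ z).
    by apply: gen; have := PN j; rewrite coefMn.
  exists (\sum_(j < size P) y (2 ^ j * (k j).*2.+1)%N *~ z j).
    have sF := spanned_subgroup y.
    elim/big_rec: _ => [|j x _]; first exact: sF.1.
    by apply: subgroupD => //; apply: subgroupMz => //; apply: mem_spanned.
  apply/esym/eqP; rewrite -subr_eq0 raddf_sum.
  rewrite (eq_bigr (fun j : 'I_(size P) => p ((u (k j) *~ z j) *: 'X^j))); last first.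
    move=> j _; rewrite raddfMz aE /av.
    have [i0 [-> ->]] := odd_part_code j (k j).
    by rewrite gtn_eqF // /mono -raddfMz scalerMzl.
  rewrite -raddf_sum -raddfB; apply/eqP; rewrite pker => i.
  rewrite coefB -(poly_def (size P) (fun j => u (k j) *~ z j)) coef_poly.
  case: ltnP => [_|iP]; first exact: kz.
  by rewrite nth_default // subr0; exact: sR.1.
- move=> _ [n [c ->]]; rewrite raddf_comb => bc0.
  apply: big1 => -[i lt_in] _ /=; apply: Ry.
  have : p (\poly_(j < n) (u j *~ c j)) = 0.
    rewrite poly_def raddf_sum -[RHS]bc0; apply: eq_bigr => j _ /=.
    by rewrite bE /mono -raddfMz scalerMzl.
  by move=> /pker/(_ i); rewrite coef_poly lt_in.
- exists (y 0); split; [exact: mem_spanned| |by rewrite aE].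
  move=> y0; apply: u0; rewrite -[u 0]mulr1z.
  apply: (yR 1%N (fun=> 1) 0 _ 0%N) => //.
  by rewrite /comb big_ord1 y0 mul0rz mul0rn.
Qed.

(* [s g] is [g] corrected by an element of [F] so that [a (s g) = b g]; modulo
   [H = F `&` ker a] it depends additively on [g]. *)
Lemma obstructed_not_bassian (G : zmodType) : obstructed G -> ~ bassian G.
Proof.
move=> /obstructed_maps[N [R [r [E [p [F [a [b [sR _ _ [aN bN]]]]]]]]]].
move=> [sF aonto binj [x [Fx x0 ax0]]]; apply.
pose H := [set g | F g /\ a g = 0].
have sH : subgroup H.
  split; first by split; [exact: sF.1|rewrite raddf0].
  by move=> g h [Fg ag] [Fh ah]; split; [exact: sF.2|rewrite raddfB ag ah subr0].
have [K [q [qsurj qker]]] := quotient_zmod sH.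
have /choice[s sP] g : exists g', F (g' - g) /\ a g' = b g.
  have [|f Ff af] := aonto (b g - a g); first by rewrite mulrnBl aN bN subr0.
  by exists (g + f); rewrite addrAC subrr add0r raddfD af addrC subrK.
have [g h|h hE] := @additive_of G K (q \o s).
  apply/eqP; rewrite -subr_eq0 -raddfD -raddfB; apply/eqP/qker.
  have [[sgF sga] [shF sha]] := (sP g, sP h); have [sF' sa] := sP (g + h).
  rewrite /H /=; split; last by rewrite raddfB raddfD sa sga sha raddfD subrr.
  have -> : s (g + h) - (s g + s h) = s (g + h) - (g + h) - ((s g - g) + (s h - h)).
    by rewrite [_ + (s h - h)]addrACA -opprD opprB addrA subrK.
  by apply: sF.2 => //; apply: subgroupD.
exists K, q, h; split=> //; split; first by exists x; split=> //; apply/qker.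
apply: raddf_inj => g; rewrite hE /= => /qker[Fs as0].
have [sgF sga] := sP g; apply: binj; last by rewrite -sga.
by rewrite -[g](subKr (s g)); apply: sF.2.
Qed.

(** The quotient of [G] by the kernel of [a] is identified by [i] with the [N]-torsion of [E]. There
    multiplication by ['X] is an injective endomorphism whose image is complemented by the
    constants, and the class of [r] is a nonzero constant. *)
Lemma obstructed_not_sdf (G : zmodType) : obstructed G -> ~ sclass directly_finite G.
Proof.
move=> /obstructed_maps[N [R [r [E [p [F [a [b [sR [nRr RrN] [psurj pker]]]]]]]]]].
move=> [aN _] [_ aonto _ _] [_ dfG].
have skera : subgroup [set g | a g = 0].
  by split=> [|g h ag ah] /=; rewrite ?raddf0 // raddfB ag ah subr0.
have [K [q [qsurj qker]]] := quotient_zmod skera.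
have [i iq] := factor qsurj (fun x => (qker x).1).
have i_inj : injective i.
  by apply: raddf_inj => k; have [g <-] := qsurj k; rewrite iq => /qker.
have iN k : i k *+ N = 0 by have [g <-] := qsurj k; rewrite iq aN.
have ionto e : e *+ N = 0 -> exists k, i k = e.
  by move=> /aonto[g _ <-]; exists (q g).
have coefXp (P : {poly rat}) j : ('X * P)`_j.+1 = P`_j by rewrite coefXM.
have pN P : p P *+ N = 0 <-> forall j, R (P`_j *+ N).
  rewrite -raddfMn pker; split=> PN j; have := PN j; by rewrite coefMn.
have [sh0 sh0E] := @additive_of {poly rat} E (fun P => p ('X * P))
  (fun P Q => etrans (congr1 p (mulrDr _ _ _)) (raddfD p _ _)).
have [|sh shE] := factor (f := sh0) psurj.
  move=> P /pker RP; rewrite sh0E pker => -[|j]; last by rewrite coefXp.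
  by rewrite coefXM; exact: sR.1.
have sh_inj : injective sh.
  apply: raddf_inj => e; have [P <-] := psurj e; rewrite shE sh0E => /pker RP.
  by apply/pker => j; have := RP j.+1; rewrite coefXp.
have /choice[f fP] k : exists k', i k' = sh (i k).
  by apply: ionto; rewrite -raddfMn iN raddf0.
have [x y|fa faE] := @additive_of K K f.
  by apply: i_inj; rewrite raddfD !fP !raddfD.
have iP k : exists P, i k = p P by have [P] := psurj (i k); exists P.
apply: (dfG K q qsurj); exists fa, [set k | exists c, i k = p c%:P]; split.
  apply: raddf_inj => k; rewrite faE => /(congr1 i); rewrite fP raddf0 => sh0k.
  by apply: i_inj; rewrite raddf0; apply: sh_inj; rewrite sh0k raddf0.
split; first by exists 0; rewrite !raddf0.
split; first by move=> x y [c xc] [d yd]; exists (c - d); rewrite !raddfB xc yd.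
split.
  have [|k kr] := ionto (p r%:P).
    apply/pN => -[|j]; rewrite coefC ?mul0rn //=; exact: sR.1.
  exists k; split; first by exists r.
  move=> k0; apply: nRr; have : p r%:P = 0 by rewrite -kr k0 raddf0.
  by move=> /pker/(_ 0%N); rewrite coefC.
split.
  move=> k; have [P kP] := iP k.
  have PN : forall j, R (P`_j *+ N) by apply/pN; rewrite -kP.
  have [|k' k'E] := ionto (p (drop_poly 1 P)).
    by apply/pN => j; rewrite coef_drop_poly.
  have [|c cE] := ionto (p (P`_0)%:P).
    apply/pN => -[|j]; rewrite coefC //= mul0rn; exact: sR.1.
  exists k', c; split; first by exists P`_0.
  apply: i_inj; rewrite raddfD faE fP k'E cE shE sh0E -raddfD kP; congr (p _).
  apply/polyP => -[|j]; rewrite coefD coefC coefXM /= ?add0r //.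
  by rewrite addr0 coef_drop_poly addn1.
move=> k [c]; rewrite faE fP => shk.
have [P kP] := iP k.
suff k0 : k = 0 by apply: i_inj; rewrite fP k0 !raddf0.
apply: i_inj; rewrite raddf0 kP; apply/pker => j.
have : p ('X * P - c%:P) = 0 by rewrite raddfB -sh0E -shE -kP shk subrr.
by move=> /pker/(_ j.+1); rewrite coefB coefXp coefC subr0.
Qed.

(** * Infinite ranks give obstructions *)

(** The second hypothesis says that [Q n] looks only at the first [n] terms, so the finite list of
    choices made so far, padded by [t0], can stand for the whole sequence. *)
Lemma dependent_sequence (T : Type) (t0 : T) (Q : nat -> (nat -> T) -> T -> Prop) :
  (forall n e, exists t, Q n e t) ->
  (forall n e e' t, (forall i, (i < n)%N -> e i = e' i) -> Q n e t -> Q n e' t) ->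
  exists y, forall n, Q n y (y n).
Proof.
move=> exQ eqQ.
have /choice[g gP] (x : nat * (nat -> T)) := exQ x.1 x.2.
pose s := fix s n := if n is m.+1 then rcons (s m) (g (m, nth t0 (s m))) else [::].
have ss n : size (s n) = n by elim: n => //= n IH; rewrite size_rcons IH.
pose y n := nth t0 (s n.+1) n.
have sy n i : (i < n)%N -> nth t0 (s n) i = y i.
  elim: n => // n IH; rewrite ltnS leq_eqVlt => /orP[/eqP -> //|lt_in].
  by rewrite /= nth_rcons ss lt_in IH.
exists y => n; apply: (eqQ n (nth t0 (s n))); first by move=> i /sy.
by rewrite /y /= nth_rcons ss ltnn eqxx; exact: (gP (n, _)).
Qed.

(** Only 0 is divisible by 0, so [m = 0] is independence over Z, while [m = p] is linear
    independence over F_p for elements of the p-socle. *)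
Definition independent (G : zmodType) (m n : nat) (e : nat -> G) : Prop :=
  forall c, comb e n c = 0 -> forall i, (i < n)%N -> (m%:Z %| c i)%Z.

Definition finite_rank (G : zmodType) : Prop :=
  exists r, forall e : nat -> G, ~ independent 0 r e.

Lemma integral_left_kernel n (A : 'M[int]_(n.+1, n)) :
  exists2 v : 'rV[int]_n.+1, v != 0 & v *m A = 0.
Proof.
pose B := map_mx (intr : int -> rat) A.
have : kermx B != 0.
  by rewrite kermx_eq0 /row_free neq_ltn ltnS rank_leq_col.
case/rowV0Pn => w /sub_kermxP wB w0.
pose M : int := \prod_i denq (w 0 i).
have M0 : M != 0 by rewrite /M; elim/big_rec: _ => // i z _; apply: mulf_neq0; exact: denq_neq0.
have /choice[v vE] i : exists z : int, z%:~R = w 0 i * M%:~R.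
  exists (numq (w 0 i) * \prod_(j < n.+1 | j != i) denq (w 0 j)).
  by rewrite intrM numqE -mulrA -intrM /M [in RHS](bigD1 i).
have vB : map_mx (intr : int -> rat) (\row_i v i) = M%:~R *: w.
  by apply/rowP => i; rewrite !mxE vE mulrC.
exists (\row_i v i).
  apply: contraNneq w0 => v0; move: vB; rewrite v0 map_mx0 => /esym/eqP.
  by rewrite scaler_eq0 intr_eq0 (negPf M0).
have : map_mx (intr : int -> rat) (\row_i v i *m A) = 0.
  by rewrite map_mxM /= vB -scalemxAl wB scaler0.
move=> /rowP vA; apply/rowP => j; apply: (@intr_inj rat).
by have := vA j; rewrite !mxE.
Qed.

(** Steinitz exchange over Z: the [n.+1] coefficient rows of length [n] satisfy an integral relation
    [v], and the products [m k * v k] then form a relation among the [e' k]. *)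
Lemma exchange (G : zmodType) n (e : nat -> G) :
  (forall g, exists (m : int) c, m != 0 /\ g *~ m = comb e n c) ->
  forall e' : nat -> G, ~ independent 0 n.+1 e'.
Proof.
move=> span e' ind.
have /choice[m /choice[c mc]] i := span (e' i).
have [v v0 vA] := integral_left_kernel (\matrix_(i < n.+1, j < n) c i j).
suff v_eq0 (i : 'I_n.+1) : v 0 i = 0.
  by case/negP: v0; apply/eqP/rowP => i; rewrite v_eq0 mxE.
pose d k := m k * (if (insub k : option 'I_n.+1) is Some i then v 0 i else 0).
have dE (k : 'I_n.+1) : d k = m k * v 0 k by rewrite /d valK.
have : comb e' n.+1 d = 0.
  rewrite /comb (eq_bigr (fun k : 'I_n.+1 => \sum_(j < n) e j *~ (v 0 k * c k j))); last first.
    move=> k _; rewrite dE mulrzA (mc k).2 /comb mulrz_suml.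
    by apply: eq_bigr => j _; rewrite -mulrzA mulrC.
  rewrite exchange_big big1 //= => j _.
  rewrite -mulrz_sumr (_ : \sum_(k < _) _ = (v *m \matrix_(i < n.+1, j < n) c i j) 0 j).
    by rewrite vA mxE mulr0z.
  by rewrite mxE; apply: eq_bigr => k _; rewrite mxE.
move=> /ind/(_ i (ltn_ord i)); rewrite dvd0z dE mulf_eq0.
by rewrite (negPf (mc i).1) => /eqP.
Qed.

Lemma infinite_rank_obstructed (G : zmodType) : ~ finite_rank G -> obstructed G.
Proof.
move=> nG.
(* Each term has no nonzero multiple in the span of the earlier ones; if no such element existed,
   [exchange] would bound the rank. *)
have [||y yP] := @dependent_sequence G 0
  (fun n e g => forall (m : int) c, m != 0 -> g *~ m <> comb e n c).
- move=> n e; apply: contrapT => nex; apply: nG; exists n.+1.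
  apply: (@exchange _ _ e) => g; apply: contrapT => ng; apply: nex; exists g.
  by move=> m c m0 gm; apply: ng; exists m, c.
- move=> n e e' g ee' gP m c m0 gm; apply: (gP m c m0); rewrite gm.
  by apply: eq_comb => i /ee' ->.
have ind n c : comb y n c = 0 -> forall i, (i < n)%N -> c i = 0.
  elim: n => // n IH; rewrite /comb big_ord_recr -/(comb y n c) /= => yc.
  have cn : c n = 0.
    apply/eqP; apply: contraT => cn0; case: (yP n (c n) (fun i => c i * -1) cn0).
    by rewrite comb_mulz mulrNz mulr1z; apply/eqP; rewrite -addr_eq0 addrC yc.
  move: yc; rewrite cn mulr0z addr0 => /IH IHn i.
  by rewrite ltnS leq_eqVlt => /orP[/eqP ->|/IHn].
(* Here C = Q, and q is a multiple of the inverse of its denominator, whence the shift by one in the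
   index. *)
exists 0, [set 0], (fun k => k.+1%:R^-1), y; split.
- by split=> // x y' -> ->; rewrite subrr.
- by split=> [/eqP|k]; rewrite ?mulr0n // invr_eq0.
- move=> q _; exists `|denq q|.-1, (numq q).
  have dq : (0 < `|denq q|)%N by rewrite absz_gt0 denq_neq0.
  have -> : `|denq q|.-1.+1%:R = (denq q)%:~R :> rat.
    by rewrite prednK // -[in RHS](gtz0_abs (denq_gt0 q)).
  by rewrite -mulrzl mulrC [_ * (_)%:~R]mulrC divq_num_den subrr.
- move=> n c g; rewrite mulr0n => /ind c0 i k /andP[_ /c0 ->]; exact: mulr0z.
- move=> i c /eqP; rewrite -mulrzl mulf_eq0 invr_eq0 pnatr_eq0 orbF intr_eq0.
  by move=> /eqP ->; rewrite mulr0z.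
Qed.

Lemma finite_comb_residues (G : zmodType) (x : nat -> G) (p n : nat) :
  finite_set [set g | exists c, (forall i, (i < n)%N -> 0 <= c i < p%:Z) /\
                                g = comb x n c].
Proof.
elim: n => [|n IH].
  apply: sub_finite_set (finite_set1 0) => g [c [_ ->]].
  by rewrite /comb big_ord0.
apply: sub_finite_set (finite_image2 (fun a k => a + x n *+ k) IH (finite_II p)).
move=> g [c [cp ->]]; have /andP[cn0 cnp] := cp n (ltnSn n).
exists (comb x n c); first by exists c; split=> // i /ltnW lt_in; apply: cp.
exists `|c n|%N; first by rewrite /= -ltz_nat gez0_abs.
by rewrite /comb big_ord_recr /= pmulrn gez0_abs.
Qed.

Lemma finite_comb_torsion (G : zmodType) (x : nat -> G) (p n : nat) : (0 < p)%N ->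
  (forall i, (i < n)%N -> x i *+ p = 0) ->
  finite_set [set g | exists c, g = comb x n c].
Proof.
move=> p0 xp; apply: sub_finite_set (finite_comb_residues x p n) => g [c ->].
have p0' : p%:Z != 0 by rewrite eqz_nat -lt0n.
exists (fun i => (c i %% p)%Z); split=> [i _|].
  by rewrite modz_ge0 //= ltz_pmod.
apply: eq_comb => i /xp xi; rewrite {1}(divz_eq (c i) p) mulrzDr mulrC mulrzA.
by rewrite -pmulrn xi mul0rz add0r.
Qed.

Definition torsion_socle (G : zmodType) (p : nat) : set G := [set x | x *+ p = 0].
Arguments torsion_socle : clear implicits.

Lemma bezout_dvd (a : int) (p e : nat) : prime p -> ~~ (p%:Z %| a)%Z ->
  exists u v : int, u * a + v * (p ^ e)%N%:Z = 1.
Proof.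
move=> pp npa; have [u [v uv]] := Bezoutz a (p ^ e)%N.
exists u, v; rewrite uv; apply/eqP; change (coprimez a (p ^ e)%N).
rewrite /coprimez /gcdz eqz_nat -/(coprime _ _) coprimeXr // coprime_sym.
by rewrite prime_coprime.
Qed.

(* [eps] and [N] cover both kinds of infinite p-rank: unbounded exponents with
   [N = 0], or a constant exponent with [N = p ^ n]. *)
Lemma torsion_family (G : zmodType) (p N : nat) (eps : nat -> nat) : prime p ->
  finite_set [set w : G | w *+ p = 0 /\ exists g, w = g *+ N] ->
  (forall i, infinite_set [set x : G | x *+ p = 0 /\ exists g, x = g *+ p ^ eps i]) ->
  exists y : nat -> G, (forall i, y i *+ p ^ (eps i).+1 = 0) /\
    forall n c g, comb y n c = g *+ N ->
      forall i, (i < n)%N -> ((p ^ (eps i).+1)%N%:Z %| c i)%Z.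
Proof.
move=> pp finW infP; have p0 := prime_gt0 pp.
pose x (e : nat -> G) i := e i *+ p ^ eps i.
(* The socle element [x y n] is chosen outside the finite set W + <x_0, ..., x_(n-1)>, where W is
   the part of the socle inside [N G]. The premise on [x e i] holds along the constructed sequence;
   for other [e] the span may be infinite, and 0 is a valid choice. *)
have [||y yP] := @dependent_sequence G 0 (fun n e g => g *+ p ^ (eps n).+1 = 0 /\
   ((forall i, (i < n)%N -> x e i *+ p = 0) ->
    forall c w, w *+ p = 0 -> (exists g, w = g *+ N) ->
      g *+ p ^ eps n <> w + comb (x e) n c)).
- move=> n e.
  have [xp|nxp] := pselect (forall i, (i < n)%N -> x e i *+ p = 0); last first.
    by exists 0; split; rewrite ?mul0rn.
  have := finite_image2 +%R finW (finite_comb_torsion p0 xp).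
  move=> /(infinite_setD (infP n))/infinite_setN0[z [[zp [g zE]] zn]].
  exists g; rewrite expnSr mulrnA -zE; split=> // _ c w wp wN zE'; apply: zn.
  by exists w => //; exists (comb (x e) n c) => //; exists c.
- move=> n e e' g ee' [gp gP]; split=> // xp c w wp wN; rewrite /x.
  rewrite -(@eq_comb _ (x e) _ n c); last by move=> i /ee'; rewrite /x => ->.
  by apply: gP => // i lt_in; rewrite /x ee' //; apply: xp.
have xp i : x y i *+ p = 0 by rewrite /x -mulrnA -expnSr; case: (yP i).
have yx n : forall c w, w *+ p = 0 -> (exists g, w = g *+ N) ->
      x y n <> w + comb (x y) n c by case: (yP n) => _; apply=> i _; apply: xp.
exists y; split=> [i|]; first by case: (yP i).
have xind n c g : comb (x y) n c = g *+ N -> forall i, (i < n)%N -> (p%:Z %| c i)%Z.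
  elim: n c g => // n IH c g cE.
  have cn : (p%:Z %| c n)%Z.
    (* Otherwise inverting [c n] modulo p would put [x y n] into the set that it avoids. *)
    apply/negPn/negP => /(bezout_dvd 1 pp)[u [v uv]].
    apply: (yx n (fun i => c i * (- u)) (comb (x y) n.+1 c *~ u)).
    - rewrite pmulrn mulrzAC -pmulrn (_ : _ *+ p = 0) ?mul0rz // /comb -sumrMnl big1 // => i _.
      by rewrite pmulrn mulrzAC -pmulrn xp mul0rz.
    - by exists (g *~ u); rewrite cE !pmulrn mulrzAC.
    - rewrite comb_mulz mulrNz {1}/comb big_ord_recr -/(comb (x y) n c) /= mulrzDl.
      rewrite addrAC subrr add0r -mulrzA mulrC.
      rewrite -[LHS]mulr1z -uv mulrzDr mulrC [v * _]mulrC expn1.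
      by rewrite [x y n *~ (p%:Z * v)]mulrzA -pmulrn xp mul0rz addr0 mulrC.
  have [q qE] := dvdzP cn.
  have cE' : comb (x y) n c = g *+ N.
    rewrite -cE /comb big_ord_recr /= qE mulrC mulrzA -pmulrn xp mul0rz addr0 //.
  by move=> i; rewrite ltnS leq_eqVlt => /orP[/eqP -> //|/(IH _ _ cE')].
move=> n c g cE.
(* Descent on [t], started at an exponent where divisibility is trivial. If it holds for p^(t+1) c,
   then each p^t c_j y_j is a multiple b_j of the socle element [x y j], and [xind] supplies the
   missing factor p of b_j. *)
have step t : (forall i, (i < n)%N -> ((p ^ (eps i).+1)%N%:Z %| (p ^ t)%N%:Z * c i)%Z) ->
    forall i, (i < n)%N -> ((p ^ (eps i).+1)%N%:Z %| c i)%Z.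
  elim: t => [|t IH] div; first by move=> i /div; rewrite expn0 mul1r.
  apply: IH => i lt_in.
  have /choice[b bE] j : exists b : int, (j < n)%N -> (p ^ t)%N%:Z * c j = b * (p ^ eps j)%N%:Z.
    have [jn|] := boolP (j < n)%N; last by exists 0.
    have := div j jn; rewrite !expnS !PoszM -mulrA dvdz_mul2l; last by case: (p) p0.
    by move=> /dvdzP[b ->]; exists b.
  have bE' : comb (x y) n b = (g *+ p ^ t) *+ N.
    rewrite mulrnAC -cE pmulrn -comb_mulz; apply: eq_comb => j jn.
    by rewrite mulrC bE // /x mulrC mulrzA -pmulrn.
  rewrite bE // expnS PoszM; apply: dvdz_mul => //; exact: (xind _ _ _ bE').
apply: (step (\sum_(i < n) (eps i).+1)%N) => i lt_in.
apply: dvdz_mulr; rewrite dvdzE /= dvdn_exp2l //.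
by rewrite (bigD1 (Ordinal lt_in)) //= leq_addr.
Qed.

Definition localized_int (p : nat) : set rat :=
  [set q | exists (m : nat) (z : int), ~~ (p %| m)%N /\ q *+ m = z%:~R].

Lemma localized_int_subgroup p : prime p -> subgroup (localized_int p).
Proof.
move=> pp; split; first by exists 1%N, 0; rewrite dvdn1 mul0rn gtn_eqF ?prime_gt1.
move=> a b [m [z [pm az]]] [m' [z' [pm' bz]]].
exists (m * m')%N, (z *+ m' - z' *+ m); split.
  by rewrite Euclid_dvdM // negb_or pm.
by rewrite mulrnBl mulrnA az [(m * m')%N]mulnC mulrnA bz rmorphB /= !rmorphMn.
Qed.

Lemma localized_int_frac p e (c : int) : prime p ->
  localized_int p ((p ^ e)%:R^-1 *~ c) -> ((p ^ e)%N%:Z %| c)%Z.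
Proof.
move=> pp [m [z [pm cz]]].
have pe0 : ((p ^ e)%:R : rat) != 0 by rewrite pnatr_eq0 -lt0n expn_gt0 prime_gt0.
have E : c * m = z * (p ^ e)%N.
  apply: (@intr_inj rat); rewrite !intrM -cz -[_^-1 *~ c]mulrzr -[_ *+ m]mulr_natr.
  by rewrite -!pmulrn [RHS]mulrC !mulrA mulfV // mul1r.
have : ((p ^ e)%N%:Z %| c * m)%Z by rewrite E dvdz_mull.
rewrite Gauss_dvdzl // /coprimez /gcdz eqz_nat -/(coprime _ _) /=.
by rewrite coprimeXl // prime_coprime.
Qed.

Lemma localized_int_gen p e (q : rat) : prime p ->
  localized_int p (q *+ p ^ e) ->
  exists z : int, localized_int p (q - (p ^ e)%:R^-1 *~ z).
Proof.
move=> pp [m [a [pm qa]]].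
have [u [v uv]] := @bezout_dvd m p e pp pm.
have pe0 : ((p ^ e)%:R : rat) != 0 by rewrite pnatr_eq0 -lt0n expn_gt0 prime_gt0.
(* Since q p^e m = a and u m + v p^e = 1, the difference q - a u / p^e equals q v p^e, and [m] times
   it is a v. *)
exists (a * u), m, (a * v); split=> //.
have qE : q * (p ^ e)%:R * m%:R = a%:~R by rewrite -qa -[RHS]mulr_natr -[q *+ _]mulr_natr.
have uv' : v%:~R * (p ^ e)%:R = 1 - u%:~R * m%:R :> rat.
  by apply/eqP; rewrite eq_sym subr_eq addrC !pmulrn -!intrM -intrD uv.
rewrite -[_ *+ m]mulr_natr -[_^-1 *~ (a * u)]mulrzr !intrM -qE.
move: ((p ^ e)%:R : rat) pe0 uv' => P P0 uv'.
have -> : P^-1 * (q * P * m%:R * u%:~R) = q * (u%:~R * m%:R).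
  by rewrite [LHS]mulrC -!mulrA [P * _]mulrC -!mulrA mulVf // mulr1 [m%:R * _]mulrC.
rewrite -{1}[q]mulr1 -mulrBr -uv'.
by rewrite -!mulrA; congr (_ * _); rewrite mulrC -mulrA.
Qed.

Lemma localized_int_pdenom p (q : rat) : prime p ->
  exists e, localized_int p (q *+ p ^ e).
Proof.
move=> pp; pose d := `|denq q|%N.
have d0 : (0 < d)%N by rewrite absz_gt0 denq_neq0.
exists (logn p d), (d`_p^')%N, (numq q); split.
  by rewrite -prime_coprime // (@pnat_coprime p) ?pnat_id ?part_pnat.
rewrite -mulrnA -p_part partnC // numqE -mulr_natr; congr (_ * _).
by rewrite pmulrn (gtz0_abs (denq_gt0 q)).
Qed.

Lemma infinite_socle_obstructed (G : zmodType) p : prime p ->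
  infinite_set (torsion_socle G p) -> obstructed G.
Proof.
move=> pp infG; have p0 := prime_gt0 pp.
pose P n := [set x : G | x *+ p = 0 /\ exists g, x = g *+ p ^ n].
suff [N [eps [y [mono [y0 yN] [gen epsN]]]]] : exists N (eps : nat -> nat) (y : nat -> G),
   [/\ {homo eps : i j / (i <= j)%N},
     (forall i, y i *+ p ^ (eps i).+1 = 0) /\
     (forall n c g, comb y n c = g *+ N ->
       forall i, (i < n)%N -> ((p ^ (eps i).+1)%N%:Z %| c i)%Z)
     & (forall q, localized_int p (q *+ N) ->
          exists k, localized_int p (q *+ p ^ (eps k).+1)) /\
       (forall k, exists z, N = (z * p ^ (eps k).+1)%N)].
  have intR (z : int) : localized_int p z%:~R.
    by exists 1%N, z; rewrite dvdn1 gtn_eqF ?prime_gt1.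
  have pe0 e : ((p ^ e)%:R : rat) != 0 by rewrite pnatr_eq0 -lt0n expn_gt0 p0.
  have divR e (c : int) : ((p ^ e)%N%:Z %| c)%Z -> localized_int p ((p ^ e)%:R^-1 *~ c).
    move=> /dvdzP[z ->]; rewrite mulrC mulrzA -pmulrn -[_^-1 *+ _]mulr_natr mulVf //.
  exists N, (localized_int p), (fun k => (p ^ (eps k).+1)%:R^-1), y; split.
  - exact: localized_int_subgroup.
  - split=> [|k].
      rewrite -[_^-1]mulr1z => /(localized_int_frac pp).
      by rewrite dvdzE /= dvdn1 expnS muln_eq1 gtn_eqF ?prime_gt1.
    by have [z ->] := epsN k; rewrite pmulrn; apply: divR; rewrite PoszM dvdz_mull.
  - move=> q /gen[k /(localized_int_gen pp)[z zk]]; by exists k, z.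
  - move=> n c g /yN cN i k /andP[ki lt_in]; apply: divR.
    apply: dvdz_trans (cN i lt_in); rewrite dvdzE /= dvdn_exp2l // ltnS; exact: mono.
  - move=> i c /(localized_int_frac pp)/dvdzP[z ->].
    by rewrite mulrC mulrzA -pmulrn y0 mul0rz.
have [infP|/existsNP finP] := pselect (forall n, infinite_set (P n)).
  have [|y [y0 yN]] := @torsion_family G p 0 id pp _ infP.
    apply: sub_finite_set (finite_set1 0) => w [_ [g ->]]; exact: mulr0n.
  exists 0%N, id, y; split=> //; split=> [q _|k]; last by exists 0%N.
  have [e [m [z [pm qz]]]] := localized_int_pdenom q pp.
  exists e, m, (z *+ p); split=> //.
  by rewrite expnSr mulrnA [_ *+ p *+ m]mulrnAC qz rmorphMn.
have ex : exists n, `[< finite_set (P n) >].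
  by have [n /contrapT fP] := finP; exists n; apply/asboolP.
(* The least exponent is not 0, as [P 0] is the whole socle. So [P n] is still infinite, and
   [P n.+1] is the finite set to avoid. *)
case: (ex_minnP ex) => -[|n] /asboolP fP nmin.
  case: infG; apply: sub_finite_set fP => x px; split=> //.
  by exists x; rewrite expn0 mulr1n.
have [i|y [y0 yN]] := @torsion_family G p (p ^ n.+1) (fun=> n) pp fP.
  by move=> /asboolP/nmin; rewrite ltnn.
exists (p ^ n.+1)%N, (fun=> n), y; split=> //.
by split=> [q Rq|_]; [exists 0%N|exists 1%N; rewrite mul1n].
Qed.

(** * Groups of finite ranks *)

Definition finite_ranks (G : zmodType) : Prop :=
  finite_rank G /\ forall p, prime p -> finite_set (torsion_socle G p).

Lemma not_obstructed_finite_ranks (G : zmodType) : ~ obstructed G -> finite_ranks G.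
Proof.
move=> nG; split; first by apply: contrapT => /infinite_rank_obstructed.
by move=> p pp; apply: contrapT => /(infinite_socle_obstructed pp).
Qed.

Lemma finite_ranks_of_sdf (G : zmodType) : sclass directly_finite G -> finite_ranks G.
Proof.
by move=> sG; apply: not_obstructed_finite_ranks => /obstructed_not_sdf; apply.
Qed.

Lemma finite_ranks_of_bassian (G : zmodType) : bassian G -> finite_ranks G.
Proof.
by move=> bG; apply: not_obstructed_finite_ranks => /obstructed_not_bassian; apply.
Qed.

Lemma finite_uniq_seq (T : eqType) (A : set T) : finite_set A ->
  exists2 s : seq T, uniq s & forall x, x \in s <-> A x.
Proof.
move=> /finite_seqP[s ->]; exists (undup s); first exact: undup_uniq.
by move=> x; rewrite mem_undup.
Qed.

Lemma finite_inj_surj (T : eqType) (A : set T) (f : T -> T) :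
  finite_set A -> injective f -> (forall x, A x -> A (f x)) ->
  forall x, A x -> exists2 a, A a & f a = x.
Proof.
move=> /finite_uniq_seq[s us sA] finj fA x /sA xs.
have fs : {subset map f s <= s} by move=> _ /mapP[a /sA /fA/sA fa ->].
have ufs : uniq (map f s) by rewrite map_inj_uniq.
have [_ E] := uniq_min_size ufs fs (eq_leq (esym (size_map f s))).
by move: xs; rewrite -E => /mapP[a /sA Aa ->]; exists a.
Qed.

Lemma torsion_prime_multiple (G : zmodType) (x : G) (m : nat) :
  (0 < m)%N -> x *+ m = 0 -> x <> 0 ->
  exists p k, [/\ prime p, x *+ k <> 0 & x *+ k *+ p = 0].
Proof.
elim/ltn_ind: m => m IH m0 xm x0.
have m1 : (1 < m)%N by case: m m0 xm {IH} => // -[|//] _; rewrite mulr1n.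
have pp := pdiv_prime m1; have dm := pdiv_dvd m.
have kE : (m %/ pdiv m * pdiv m)%N = m by rewrite divnK.
have [xk|/eqP xk] := eqVneq (x *+ (m %/ pdiv m)) 0; last first.
  by exists (pdiv m), (m %/ pdiv m)%N; rewrite -mulrnA kE.
apply: (IH _ _ _ xk x0); first by rewrite ltn_Pdiv ?prime_gt1.
by rewrite divn_gt0 ?prime_gt0 // dvdn_leq.
Qed.

(** An injective endomorphism permutes each finite socle, so [C] meets every socle only in 0 and is
    torsion-free. The iterates of [f] on a nonzero [c] in [C] are then independent: in a relation
    the term in [c] lies both in [C] and in the image of [f], hence vanishes, and [f] can be
    cancelled from the rest. *)
Lemma finite_ranks_directly_finite (G : zmodType) :
  finite_ranks G -> directly_finite G.
Proof.
move=> [[r rG] fG] [f [C [finj [C0 [CB [[c [Cc c0]] [_ Cf]]]]]]].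
have sC : subgroup C by split.
have noC p x : prime p -> C x -> x *+ p = 0 -> x = 0.
  move=> pp Cx xp; have [|a _ fa] := @finite_inj_surj _ _ f (fG p pp) finj _ x xp.
    by move=> z zp; rewrite /torsion_socle /= -raddfMn zp raddf0.
  by rewrite -fa; apply: Cf; rewrite fa.
have Cn n x : C x -> C (x *+ n) by rewrite pmulrn; exact: subgroupMz.
have notors m : (0 < m)%N -> c *+ m <> 0.
  move=> m0 cm; have [p [k [pp ck ckp]]] := torsion_prime_multiple m0 cm c0.
  by apply: ck; apply: noC pp _ ckp; apply: Cn.
have notorsz (z : int) : c *~ z = 0 -> z = 0.
  move=> cz; apply/eqP; apply: contraT; rewrite -absz_gt0 => /notors; case.
  by rewrite pmulrn abszEsg mulrC mulrzA cz mul0rz.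
apply: (rG (fun i => iter i f c)) => d.
elim: r d {rG} => // n IH d; rewrite /comb big_ord_recl /=.
pose d' i := d i.+1.
have -> : \sum_(i < n) f (iter i f c) *~ d (bump 0 i) = f (comb (fun i => iter i f c) n d').
  by rewrite raddf_comb /comb; apply: eq_bigr.
move=> cd; have cd0 : c *~ d 0%N = f (- comb (fun i => iter i f c) n d').
  by rewrite raddfN; apply/eqP; rewrite -addr_eq0; apply/eqP.
have f0 : c *~ d 0%N = 0.
  by rewrite cd0; apply: Cf; rewrite -cd0; apply: subgroupMz.
move: cd; rewrite f0 add0r -[0](raddf0 f) => /finj /IH ind [|i]; last exact: ind.
by rewrite (notorsz _ f0).
Qed.

Lemma finite_preimage_additive (G K : zmodType) (f : G -> K) (B : set K) :
  (forall x y, f (x - y) = f x - f y) ->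
  finite_set [set x | f x = 0] -> finite_set B -> finite_set (f @^-1` B).
Proof.
move=> fB fker fB'.
have /choice[s sP] k : exists g, (exists g', f g' = k) -> f g = k.
  by have [[g gk]|nk] := pselect (exists g', f g' = k); [exists g|exists 0].
apply: sub_finite_set (finite_image2 (fun k x => s k + x) fB' fker) => g Bg.
exists (f g) => //; exists (g - s (f g)); last by rewrite addrC subrK.
by rewrite /= fB sP ?subrr //; exists g.
Qed.

Lemma finite_mulrn_preimage (G : zmodType) p (B : set G) :
  finite_set (torsion_socle G p) -> finite_set B ->
  finite_set [set x | B (x *+ p)].
Proof.
by move=> fG fB; apply: (@finite_preimage_additive G G (fun x => x *+ p)) => // x y;
   rewrite mulrnBl.
Qed.

Lemma finite_torsion_exp (G : zmodType) p k :
  finite_set (torsion_socle G p) -> finite_set (torsion_socle G (p ^ k)).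
Proof.
move=> fG; elim: k => [|k IH].
  by apply: sub_finite_set (finite_set1 0) => x; rewrite /torsion_socle /= mulr1n.
apply: sub_finite_set (finite_mulrn_preimage fG IH) => x.
by rewrite /torsion_socle /= expnS mulrnA.
Qed.

(** If [m] kills p^e g and u inverts the p'-part of [m] modulo p^e, then g times u times that
    p'-part has the same image as [g] and is killed by a power of p. *)
Lemma torsion_lift (G K : zmodType) (f : {additive G -> K}) p e g :
  prime p -> (forall x, f x = 0 -> exists2 m, (0 < m)%N & x *+ m = 0) ->
  f g *+ p ^ e = 0 -> exists g' t, f g' = f g /\ g' *+ p ^ t = 0.
Proof.
move=> pp ftors kp; have [|m m0 gm] := ftors (g *+ p ^ e); first by rewrite raddfMn.
have mE := partnC p m0.
have [|u [v uv]] := @bezout_dvd (m`_p^')%N p e pp.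
  by rewrite dvdzE /= -prime_coprime // (@pnat_coprime p) ?pnat_id ?part_pnat.
exists (g *+ m`_p^' *~ u), (logn p m + e)%N; split.
  rewrite raddfMz raddfMn -[RHS]mulr1z -uv mulrzDr mulrC mulrzA -pmulrn.
  rewrite mulrzA -pmulrn [f g *~ v *+ _]pmulrn [f g *~ v *~ _]mulrzAC.
  by rewrite -[f g *~ (_ ^ _)%N]pmulrn kp mul0rz addr0.
rewrite pmulrn mulrzAC -pmulrn -mulrnA (_ : (_ * _)%N = (p ^ e * m)%N) ?mulrnA ?gm ?mul0rz //.
by rewrite expnD -p_part mulnA [(m`_p^' * _)%N]mulnC mE mulnC.
Qed.

(** A count shows that the socle does not grow. Let B be a finite part of the socle of [K], lifted
    to elements killed by p^T, and let C be the kernel of [f] within the p^T-torsion. The |B| |C|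
    sums of a lift and an element of C are distinct, and multiplication by p sends them into C with
    fibres no larger than the socle of [G]. *)
Lemma finite_socle_torsion_quotient (G K : zmodType) (f : {additive G -> K}) p :
  prime p -> (forall k, exists g, f g = k) ->
  (forall x, f x = 0 -> exists2 m, (0 < m)%N & x *+ m = 0) ->
  finite_set (torsion_socle G p) -> finite_set (torsion_socle K p).
Proof.
move=> pp fsurj ftors fG; apply: contrapT => infK.
have p0 := prime_gt0 pp.
have /choice[l /choice[t lt]] k : exists g t, k *+ p = 0 -> f g = k /\ g *+ p ^ t = 0.
  have [kp|] := pselect (k *+ p = 0); last by exists 0, 0%N.
  have [g gk] := fsurj k; rewrite -gk in kp *.
  have [g' [t tP]] := torsion_lift (e := 1) pp ftors kp.
  by exists g', t.
have [s0 us0 s0P] := finite_uniq_seq fG.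
have [B BK dB] := infinite_set_fset (size s0).+1 infK.
pose T := (\sum_(k <- B) t k)%N.
have tT k : k \in B -> (t k <= T)%N.
  by move=> kB; rewrite /T (big_rem k) //= leq_addr.
have fA : finite_set [set a | a *+ p ^ T = 0 /\ f a = 0].
  by apply: sub_finite_set (finite_torsion_exp T fG) => a [].
have [C uC CP] := finite_uniq_seq fA.
have /choice[r rP] a : exists x : G, (exists x', x' *+ p = a) -> x *+ p = a.
  by have [[x xa]|nx] := pselect (exists x' : G, x' *+ p = a); [exists x|exists 0].
have kp k : k \in B -> k *+ p = 0 by move=> kB; apply: (BK k).
have fl k : k \in B -> f (l k) = k by move=> kB; have [] := lt k (kp k kB).
have lT k : k \in B -> l k *+ p ^ T = 0.
  move=> kB; have [_ lk] := lt k (kp k kB).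
  by rewrite -(subnKC (tT k kB)) expnD mulrnA lk mul0rn.
pose X := [seq l k + a | k <- B, a <- C].
have uX : uniq X.
  apply: allpairs_uniq => //; first exact: fset_uniq.
  move=> -[k a] [k' a'].
  move=> /allpairsP[[k1 a1] [/= kB /CP[_ fa] [-> ->]]].
  move=> /allpairsP[[k2 a2] [/= kB' /CP[_ fa'] [-> ->]]] E.
  have kk : k1 = k2.
    by have := congr1 f E; rewrite /= !raddfD fa fa' !addr0 !fl.
  by move: E; rewrite kk => /addrI ->.
have sX : {subset X <= [seq r a + z | a <- C, z <- s0]}.
  move=> _ /allpairsP[[k a] [/= kB /CP[aT fa] ->]].
  pose x := l k + a; rewrite -/x.
  have xC : x *+ p \in C.
    apply/CP; split.
      by rewrite -mulrnAC mulrnDl lT // aT addr0 mul0rn.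
    by rewrite raddfMn raddfD fl // fa addr0 kp.
  apply/allpairsP; exists (x *+ p, x - r (x *+ p)); split=> //=.
    by apply/s0P; rewrite /torsion_socle /= mulrnBl rP ?subrr //; exists x.
  by rewrite addrC subrK.
have := uniq_leq_size uX sX; rewrite !size_allpairs mulnC leq_pmul2l.
  by rewrite leqNgt dB.
rewrite lt0n size_eq0; have : 0 \in C by apply/CP; split; rewrite ?mul0rn ?raddf0.
by apply: contraTneq => ->.
Qed.

Definition extend (G : zmodType) (e : nat -> G) (n : nat) (h : G) (i : nat) : G :=
  if (i < n)%N then e i else h.

Lemma comb_extend (G : zmodType) (e : nat -> G) n h c :
  comb (extend e n h) n.+1 c = comb e n c + h *~ c n.
Proof.
rewrite /comb big_ord_recr /= {2}/extend ltnn; congr (_ + _).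
by apply: eq_bigr => i _; rewrite /extend ltn_ord.
Qed.

(** The map is factored through [G]/F, with F spanned by a maximal independent family of the kernel.
    The map from [G]/F to [K] has torsion kernel, which [finite_socle_torsion_quotient] handles. A
    socle element of [G]/F has a representative g for which p g is a combination with coefficients
    in [0, p): finitely many values, each with finitely many p-th parts. *)
Lemma finite_ranks_quotient (G K : zmodType) (f : {additive G -> K}) :
  finite_ranks G -> (forall k, exists g, f g = k) -> finite_ranks K.
Proof.
move=> [[r rG] fG] fsurj; split.
  exists r => e ind; have /choice[l lf] := fsurj.
  apply: (rG (l \o e)) => c lc; apply: ind.
  have <- : f (comb (l \o e) r c) = comb e r c.
    by rewrite raddf_comb; apply: eq_comb => i _; rewrite /= lf.
  by rewrite lc raddf0.
move=> p pp; have p0 := prime_gt0 pp.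
have ex : exists n, `[< ~ exists e : nat -> G, (forall i, f (e i) = 0) /\ independent 0 n e >].
  by exists r; apply/asboolP => -[e [_ ind]]; apply: (rG e).
case: (ex_minnP ex) => -[|n] /asboolP nind nmin.
  by case: nind; exists (fun=> 0); split=> [i|c _ i]; rewrite ?raddf0.
have [e [fe ind]] : exists e : nat -> G, (forall i, f (e i) = 0) /\ independent 0 n e.
  apply: contrapT => nexe.
  have /nmin : `[< ~ exists e : nat -> G,
      (forall i, f (e i) = 0) /\ independent 0 n e >] by apply/asboolP.
  by rewrite ltnn.
pose F := [set g | exists c, g = comb e n c].
have sF : subgroup F.
  split; first by exists (fun=> 0); rewrite /comb big1 // => i _; rewrite mulr0z.
  by move=> _ _ [c ->] [d ->]; exists (fun i => c i - d i); rewrite combB.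
have fF g : F g -> f g = 0.
  by move=> [c ->]; rewrite raddf_comb /comb big1 //= => i _; rewrite fe mul0rz.
have tors h : f h = 0 -> exists2 z : int, z != 0 & F (h *~ z).
  move=> fh; apply: contrapT => nz; apply: nind.
  exists (extend e n h); split=> [i|c]; first by rewrite /extend; case: ifP.
  rewrite comb_extend => c0; have [cn|cn] := eqVneq (c n) 0.
    move: c0; rewrite cn mulr0z addr0 => /ind indc i.
    by rewrite ltnS leq_eqVlt => /orP[/eqP ->|/indc //]; rewrite cn.
  case: nz; exists (c n) => //; exists (fun i => c i * -1).
  by rewrite comb_mulz mulrNz mulr1z; apply/eqP; rewrite -addr_eq0 addrC c0.
have [Q [q [qsurj qker]]] := quotient_zmod sF.
have [f1 f1q] := factor qsurj (fun x qx => fF x ((qker x).1 qx)).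
have f1surj k : exists x, f1 x = k by have [g <-] := fsurj k; exists (q g).
apply: (finite_socle_torsion_quotient pp f1surj) => [x|].
  have [g <-] := qsurj x; rewrite f1q => /tors[z z0 /qker qz].
  exists `|z|%N; first by rewrite absz_gt0.
  by rewrite pmulrn abszEsg mulrC mulrzA -raddfMz qz mul0rz.
apply: sub_finite_set
  (finite_image q (finite_mulrn_preimage (fG p pp) (finite_comb_residues e p n))).
move=> x; have [g <-] := qsurj x; rewrite /torsion_socle /= -raddfMn => /qker[c gc].
have qc : q (comb e n (fun i => (c i %/ p)%Z)) = 0.
  by apply/qker; exists (fun i => (c i %/ p)%Z).
exists (g - comb e n (fun i => (c i %/ p)%Z)); last by rewrite raddfB qc subr0.
exists (fun i => (c i %% p)%Z); split=> [i _|].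
  by rewrite modz_ge0 ?ltz_pmod // -lt0n.
rewrite mulrnBl gc pmulrn -comb_mulz -combB; apply: eq_comb => i _.
by congr (_ *~ _); apply/eqP; rewrite subr_eq addrC -divz_eq.
Qed.

(** * Splitting off the divisible torsion part *)

Lemma finite_rank_maximal (G : zmodType) : finite_rank G ->
  exists n, (exists e : nat -> G, independent 0 n e) /\
            forall e : nat -> G, ~ independent 0 n.+1 e.
Proof.
move=> [r rG].
have ex : exists n, `[< forall e : nat -> G, ~ independent 0 n e >].
  by exists r; apply/asboolP.
case: (ex_minnP ex) => -[|n] /asboolP nind nmin.
  by case: (nind (fun=> 0)).
exists n; split=> //; apply: contrapT => ne.
suff /nmin : `[< forall e : nat -> G, ~ independent 0 n e >] by rewrite ltnn.
by apply/asboolP => e ind; apply: ne; exists e.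
Qed.

(** The kernel of [q] is torsion: otherwise lifts of the [h (e i)] and a kernel element of infinite
    order would be [n.+1] independent elements. Hence p-power torsion lifts along [q], so the image
    under [h] of the finite p-primary part lies in its image under [q]. As [h] is injective, so is
    [q] on that part, yet it kills a nonzero multiple of [x] there. *)
Lemma bassian_criterion (B : zmodType) : finite_rank B ->
  (forall p, prime p -> finite_set [set x : B | exists k, x *+ p ^ k = 0]) ->
  bassian B.
Proof.
move=> /finite_rank_maximal[n [[e ind] nind]] fB [K [q [h [qsurj [[x [x0 qx0]] hinj]]]]].
have qtors y : q y = 0 -> exists2 m, (0 < m)%N & y *+ m = 0.
  move=> qy; apply: contrapT => nm; have /choice[l lq] := qsurj.
  apply: (nind (extend (l \o (h \o e)) n y)) => c; rewrite comb_extend => c0.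
  have indc : forall i, (i < n)%N -> c i = 0.
    move=> i lt_in; apply/eqP; rewrite -dvd0z; apply: ind lt_in; apply: hinj.
    rewrite raddf0 raddf_comb -[RHS](raddf0 q) -c0 raddfD raddfMz qy mul0rz addr0.
    by rewrite raddf_comb; apply: eq_comb => j _; rewrite /= lq.
  move=> i; rewrite ltnS leq_eqVlt => /orP[/eqP ->|/indc -> //].
  rewrite dvd0z; apply: contraT => cn0; case: nm; exists `|c n|%N; rewrite ?absz_gt0 //.
  move: c0; rewrite /comb big1 ?add0r => [yc|[j lt_jn] _ /=]; last by rewrite indc ?mulr0z.
  by rewrite pmulrn abszEsg mulrC mulrzA yc mul0rz.
have [m m0 xm] := qtors x qx0.
have [p [k [pp xk0 xkp]]] := torsion_prime_multiple m0 xm x0.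
have [s us sP] := finite_uniq_seq (fB p pp).
have uhs : uniq (map h s) by rewrite map_inj_uniq.
have hq : {subset map h s <= map q s}.
  move=> _ /mapP[a /sP[e' ae] ->]; have [g gE] := qsurj (h a).
  have [|g' [t [gg' gt]]] := @torsion_lift _ _ q p e' g pp qtors.
    by rewrite gE -raddfMn ae raddf0.
  by rewrite -gE -gg'; apply: map_f; apply/sP; exists t.
have uqs : uniq (map q s) by apply: leq_size_uniq uhs hq _; rewrite !size_map.
have xs : x *+ k \in s by apply/sP; exists 1%N; rewrite expn1.
have os : 0 \in s by apply/sP; exists 0%N; rewrite mul0rn.
have : index (x *+ k) s = index 0 s.
  apply/eqP; rewrite -(nth_uniq 0 _ _ uqs) ?size_map ?index_mem //.
  rewrite !(nth_map 0) ?index_mem // !nth_index //.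
  by rewrite raddfMn qx0 mul0rn raddf0.
by move=> /(congr1 (nth 0 s)); rewrite !nth_index.
Qed.

(** Divisibility is tested in [G], not in the subgroup; the finiteness of the socles closes this gap
    in [divisible_torsion_div]. *)
Definition divisible_torsion (G : zmodType) : set G :=
  [set x | (exists2 m, (0 < m)%N & x *+ m = 0) /\
           forall k, (0 < k)%N -> exists y, y *+ k = x].

Lemma divisible_torsion_subgroup (G : zmodType) : subgroup (@divisible_torsion G).
Proof.
split; first by split=> [|k _]; [exists 1%N; rewrite ?mul0rn|exists 0; rewrite mul0rn].
move=> x y [[m m0 xm] xdiv] [[m' m0' ym] ydiv]; split.
  exists (m * m')%N; first by rewrite muln_gt0 m0.
  by rewrite mulrnBl mulrnA xm mulnC mulrnA ym !mul0rn subrr.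
move=> k k0; have [[a <-] [b <-]] := (xdiv k k0, ydiv k k0).
by exists (a - b); rewrite mulrnBl.
Qed.

(** For a prime p, [x] has finitely many p-th parts y. If each failed to be divisible by some [j y],
    let K be the sum of these: dividing [x] by K! p gives a p-th part divisible by K!, hence by its
    own [j y]. *)
Lemma divisible_torsion_div (G : zmodType) :
  (forall p, prime p -> finite_set (torsion_socle G p)) ->
  forall n (x : G), (0 < n)%N -> divisible_torsion x ->
  exists2 y, divisible_torsion y & y *+ n = x.
Proof.
move=> fG.
have primediv p x : prime p -> @divisible_torsion G x ->
    exists2 y, divisible_torsion y & y *+ p = x.
  move=> pp [[m m0 xm] xdiv]; have p0 := prime_gt0 pp.
  suff [y [yp ydiv]] : exists y, y *+ p = x /\ forall k, (0 < k)%N -> exists z, z *+ k = y.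
    exists y => //; split=> //; exists (p * m)%N; first by rewrite muln_gt0 p0.
    by rewrite mulrnA yp.
  apply: contrapT => ny.
  have /choice[j jP] y : exists k, y *+ p = x -> (0 < k)%N /\ forall z, z *+ k <> y.
    have [yp|] := pselect (y *+ p = x); last by exists 0%N.
    apply: contrapT => nk; apply: ny; exists y; split=> // k k0.
    by apply: contrapT => nz; apply: nk; exists k => _; split=> // z zk; apply: nz; exists z.
  have [s us sP] := finite_uniq_seq (finite_mulrn_preimage (fG p pp) (finite_set1 x)).
  pose K := (\sum_(y <- s) j y)%N.
  have [|z zx] := xdiv (K`! * p)%N; first by rewrite muln_gt0 fact_gt0.
  have yx : z *+ K`! *+ p = x by rewrite -mulrnA.
  have [j0 jn] := jP _ yx.
  have jK : (j (z *+ K`!) <= K)%N.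
    have : z *+ K`! \in s by apply/sP.
    by move: (z *+ _) => y ys; rewrite /K (big_rem y) //= leq_addr.
  have /dvdnP[d dE] : (j (z *+ K`!) %| K`!)%N by apply: dvdn_fact; rewrite j0.
  by apply: (jn (z *+ d)); rewrite -mulrnA -dE.
elim/ltn_ind => n IH x n0 Dx.
have [n1|n1] := leqP n 1.
  by have -> : n = 1%N by [apply/eqP; rewrite eqn_leq n1]; exists x.
have pp := pdiv_prime n1; have [y Dy yp] := primediv _ _ pp Dx.
have kE : (n %/ pdiv n * pdiv n)%N = n by rewrite divnK ?pdiv_dvd.
have [||z Dz zy] := IH (n %/ pdiv n)%N _ y _ Dy.
- by rewrite ltn_Pdiv ?prime_gt1.
- by rewrite divn_gt0 ?prime_gt0 // dvdn_leq ?pdiv_dvd.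
by exists z => //; rewrite -kE mulrnA zy.
Qed.

Lemma finite_rank_inj (G K : zmodType) (f : {additive K -> G}) :
  injective f -> finite_rank G -> finite_rank K.
Proof.
move=> finj [r rG]; exists r => e ind; apply: (rG (f \o e)) => c.
by rewrite -raddf_comb -[0](raddf0 f) => /finj/ind.
Qed.

Lemma finite_socle_inj (G K : zmodType) (f : {additive K -> G}) p :
  injective f -> finite_set (torsion_socle G p) -> finite_set (torsion_socle K p).
Proof.
move=> finj fG.
have fker : finite_set [set x | f x = 0].
  apply: sub_finite_set (finite_set1 0) => x fx.
  by apply: finj; rewrite fx raddf0.
apply: sub_finite_set (finite_preimage_additive (raddfB f) fker fG) => x xp.
by rewrite /torsion_socle /= -raddfMn xp raddf0.
Qed.

(** A nonzero socle element of infinite p-height would be divisible by every integer, against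
    reducedness. As the socle is finite, some K bounds all heights, and then p^K kills the whole
    p-primary part. *)
Lemma finite_primary_part (B : zmodType) p : prime p ->
  finite_set (torsion_socle B p) -> (forall x : B, divisible_torsion x -> x = 0) ->
  finite_set [set x : B | exists k, x *+ p ^ k = 0].
Proof.
move=> pp fB reduced; have p0 := prime_gt0 pp.
have /choice[k kP] (x : B) : exists k, x *+ p = 0 -> x <> 0 -> forall y, y *+ p ^ k <> x.
  have [xp|] := pselect (x *+ p = 0); last by exists 0%N.
  apply: contrapT => nk.
  have xdiv a : exists y, y *+ p ^ a = x.
    by apply: contrapT => ny; apply: nk; exists a => _ _ y ya; apply: ny; exists y.
  apply: nk; exists 0%N => _ x0; case: x0; apply: reduced.
  split=> [|j j0]; first by exists p.
  (* [p] kills [x], so inverting the p'-part of [j] modulo p divides [x] by that part. *)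
  have [u [v uv]] : exists u v : int, u * (j`_p^')%N%:Z + v * (p ^ 1)%N = 1.
    apply: bezout_dvd => //.
    by rewrite dvdzE /= -prime_coprime // (@pnat_coprime p) ?pnat_id ?part_pnat.
  have [y yx] := xdiv (logn p j); exists (y *~ u).
  rewrite -(partnC p j0) p_part mulrnA [y *~ u *+ _]pmulrn mulrzAC -pmulrn yx.
  rewrite [LHS]pmulrn -mulrzA -[RHS]mulr1z -uv mulrzDr expn1 [v * _]mulrC [x *~ (p%:Z * v)]mulrzA.
  by rewrite -[x *~ p]pmulrn xp mul0rz addr0.
have [s us sP] := finite_uniq_seq fB.
pose K := (\sum_(x <- s) k x)%N.
have xK (x y : B) : x *+ p = 0 -> y *+ p ^ K = x -> x = 0.
  move=> xp yx; apply: contrapT => x0.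
  have kK : (k x <= K)%N by have /sP xs := xp; rewrite /K (big_rem x) //= leq_addr.
  apply: (kP x xp x0 (y *+ p ^ (K - k x))).
  by rewrite -mulrnA -expnD subnK.
have Ktors j (x : B) : x *+ p ^ (K + j) = 0 -> x *+ p ^ K = 0.
  elim: j => [|j IH]; first by rewrite addn0.
  rewrite addnS expnSr mulrnA => /xK zK; apply: IH; apply: (zK (x *+ p ^ j)).
  by rewrite -mulrnA -expnD addnC.
apply: sub_finite_set (finite_torsion_exp K fB) => x [j xj].
by apply: (Ktors j); rewrite expnD mulnC mulrnA xj mul0rn.
Qed.

Lemma socle_basis (D : zmodType) p : prime p -> finite_set (torsion_socle D p) ->
  exists (n : nat) (x : nat -> D),
    [/\ forall i, x i *+ p = 0, independent p n x &
        forall v, v *+ p = 0 -> exists c, v = comb x n c].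
Proof.
move=> pp /finite_uniq_seq[s us sP].
pose indep n := exists x : nat -> D, (forall i, x i *+ p = 0) /\ independent p n x.
have ex : exists n, `[< ~ indep n >].
  exists (size s).+1; apply/asboolP => -[x [xp ind]].
  have xinj : {in iota 0 (size s).+1 &, injective x}.
    move=> i j; rewrite !mem_iota !add0n /= => i_s j_s xij.
    apply/eqP; apply: contraT => ij.
    have := ind (fun k => (k == i)%:Z - (k == j)%:Z).
    rewrite combB !comb_delta // xij subrr => /(_ erefl i i_s).
    by rewrite eqxx (negPf ij) subr0 dvdzE /= dvdn1 gtn_eqF ?prime_gt1.
  have : uniq (map x (iota 0 (size s).+1)) by rewrite map_inj_in_uniq ?iota_uniq.
  move=> /uniq_leq_size us'; suff /us' : {subset map x (iota 0 (size s).+1) <= s}.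
    by rewrite size_map size_iota ltnn.
  by move=> _ /mapP[i _ ->]; apply/sP; exact: xp.
case: (ex_minnP ex) => -[|n] /asboolP nind nmin.
  by case: nind; exists (fun=> 0); split=> [i|c _ i]; rewrite ?mul0rn.
have [x [xp ind]] : indep n.
  apply: contrapT => nn; have /nmin : `[< ~ indep n >] by apply/asboolP.
  by rewrite ltnn.
exists n, x; split=> // v vp; apply: contrapT => nv; apply: nind.
exists (extend x n v); split=> [i|c]; first by rewrite /extend; case: ifP.
rewrite comb_extend => c0.
have pc : (p%:Z %| c n)%Z.
  apply/negPn/negP => /(bezout_dvd 1 pp)[u [w uw]]; apply: nv.
  exists (fun i => c i * (- u)); rewrite comb_mulz mulrNz -mulNrz.
  have -> : - comb x n c = v *~ c n by apply/esym/eqP; rewrite -addr_eq0 addrC c0.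
  rewrite -[LHS]mulr1z -uw mulrzDr expn1 [w * _]mulrC [v *~ (p%:Z * w)]mulrzA.
  by rewrite -[v *~ p]pmulrn vp mul0rz addr0 mulrC mulrzA.
have [q qE] := dvdzP pc.
move: c0; rewrite qE mulrC mulrzA -pmulrn vp mul0rz addr0 => /ind indc i.
by rewrite ltnS leq_eqVlt => /orP[/eqP ->|/indc].
Qed.

Lemma primary_independence (D : zmodType) (S : nat -> D) N :
  (forall p, ~~ prime p -> S p = 0) -> (forall p, exists k, S p *+ p ^ k = 0) ->
  \sum_(p < N) S p = 0 -> forall q, (q < N)%N -> S q = 0.
Proof.
move=> Snp /choice[k Sk] S0 q qN.
have [pq|/Snp //] := boolP (prime q).
(* [M] kills every component but the one at [q], and is prime to [q]. *)
pose M := (\prod_(p < N | (p != Ordinal qN) && prime p) p ^ k p)%N.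
have qM : ~~ (q %| M)%N.
  apply: (big_ind (fun m => ~~ (q %| m)%N)) => [|a b qa qb|p /andP[pq' pp]].
  - by rewrite dvdn1 gtn_eqF ?prime_gt1.
  - by rewrite Euclid_dvdM // negb_or qa.
  - rewrite -val_eqE /= in pq'.
    by rewrite Euclid_dvdX // dvdn_prime2 // eq_sym (negPf pq').
have SM : S q *+ M = 0.
  have := congr1 (fun z => z *+ M) S0; rewrite /= mul0rn (bigD1 (Ordinal qN)) //= mulrnDl.
  rewrite -sumrMnl big1 ?addr0 // => p pq'.
  have [pp|/Snp ->] := boolP (prime p); last by rewrite mul0rn.
  by rewrite /M (bigD1 p) ?pq' //= mulrnA Sk mul0rn.
have [|u [v uv]] := @bezout_dvd M q (k q) pq; first by rewrite dvdzE.
rewrite -[LHS]mulr1z -uv mulrzDr ![_ * (_)%:Z]mulrC !mulrzA -!pmulrn SM Sk.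
by rewrite !mul0rz addr0.
Qed.

(** For [x] killed by p the map vanishes on Z, so on Z[1/p] it induces a map from Z(p^oo) with 1/p
    going to [x]. *)
Lemma rat_hom (D : zmodType) (x : D) p : divisible D -> (0 < p)%N ->
  exists chi : {additive rat -> D}, chi p%:R^-1 = x.
Proof.
move=> divD p0; pose R := [set z | exists c : int, z = (p%:R^-1 *~ c : rat, x *~ c)].
have [||chi chiP] := @divisible_extension rat D R divD.
- split; first by exists 0; rewrite !mulr0z.
  by move=> _ _ [c ->] [d ->]; exists (c - d); rewrite !mulrzBr.
- move=> e [c [/esym/eqP]]; rewrite -mulrzr mulf_eq0 invr_eq0 pnatr_eq0 gtn_eqF //=.
  by rewrite intr_eq0 => /eqP -> ->; rewrite mulr0z.
- by exists chi; apply: chiP; exists 1; rewrite !mulr1z.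
Qed.

(** * The explicit model of a divisible torsion group *)

Lemma Dsub_add n f1 f2 : Dsub n f1 -> Dsub n f2 -> Dsub n (fun s => f1 s + f2 s).
Proof.
move=> [sup1 [[N1 b1] den1]] [sup2 [[N2 b2] den2]].
have nz p i : f1 (p, i) + f2 (p, i) != 0 -> f1 (p, i) != 0 \/ f2 (p, i) != 0.
  by have [->|] := eqVneq (f1 (p, i)) 0; [rewrite add0r; right|left].
split; first by move=> p i /nz[/sup1|/sup2].
split; first by exists (maxn N1 N2) => p i /nz[/b1|/b2]; rewrite leq_max => ->; rewrite ?orbT.
move=> p i; have [[k1 [z1 e1]] [k2 [z2 e2]]] := (den1 p i, den2 p i).
exists (k1 + k2)%N, ((p ^ k2)%N%:Z * z1 + (p ^ k1)%N%:Z * z2).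
rewrite intrD !intrM -e1 -e2 mulrDr expnD natrM -!pmulrn !mulrA.
by rewrite [(p ^ k2)%:R * _]mulrC.
Qed.

(** Injectivity on the socle suffices: p^t times the relation involves only multiples of the [chi i]
    at 1/p, and independence removes one factor p from the denominators. *)
Lemma prufer_kernel (D : zmodType) (chi : nat -> {additive rat -> D}) (p n : nat) :
  prime p -> independent p n (fun i => chi i p%:R^-1) ->
  forall t (f : nat -> rat),
    (forall i, (i < n)%N -> exists z : int, (p ^ t)%:R * f i = z%:~R) ->
    \sum_(i < n) chi i (f i) = 0 ->
    forall i, (i < n)%N -> exists z : int, f i = z%:~R.
Proof.
move=> pp ind; elim=> [|t IH] f fint f0.
  by move=> i /fint[z]; rewrite expn0 mul1r => ->; exists z.
apply: IH (f0) => i lt_in.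
have p0 : (p%:R : rat) != 0 by rewrite pnatr_eq0 gtn_eqF ?prime_gt0.
have /choice[b bE] j : exists b : int, (j < n)%N -> (p ^ t)%:R * f j = b%:~R / p%:R.
  have [/fint[z zE]|_] := boolP (j < n)%N; last by exists 0.
  by exists z => _; rewrite -zE expnS natrM -mulrA [p%:R * _]mulrC mulfK.
have cb : comb (fun i => chi i p%:R^-1) n b = 0.
  have := congr1 (fun z => z *+ p ^ t) f0; rewrite /= mul0rn -sumrMnl => <-.
  apply: eq_bigr => j _; rewrite -raddfMz -raddfMn -[f j *+ _]mulr_natl bE //.
  by rewrite mulrzl.
have /dvdzP[c cE] := ind b cb i lt_in.
by exists c; rewrite bE // cE intrM -pmulrn mulfK.
Qed.

(** p^k w lies in the socle, and dividing its coordinates by p^k inside Q gives an element whose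
    difference from [w] is killed by p^k. *)
Lemma prufer_onto (D : zmodType) (chi : nat -> {additive rat -> D}) (p n : nat) :
  prime p ->
  (forall v, v *+ p = 0 -> exists c, v = comb (fun i => chi i p%:R^-1) n c) ->
  forall k w, w *+ p ^ k = 0 ->
    exists c : nat -> int, w = \sum_(i < n) chi i ((p ^ k)%:R^-1 *~ c i).
Proof.
move=> pp span; elim=> [|k IH] w wk.
  exists (fun=> 0); rewrite -[LHS]mulr1n -[1%N](expn0 p) wk big1 // => i _.
  by rewrite mulr0z raddf0.
have pe0 e : ((p ^ e)%:R : rat) != 0 by rewrite pnatr_eq0 -lt0n expn_gt0 prime_gt0.
have p0 : (p%:R : rat) != 0 by rewrite pnatr_eq0 gtn_eqF ?prime_gt0.
have [|c cE] := span (w *+ p ^ k); first by rewrite -mulrnA -expnSr.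
have pE : (p ^ k.+1)%:R^-1 *+ p ^ k = p%:R^-1 :> rat.
  by rewrite expnS natrM invfM -[LHS]mulr_natr -mulrA mulVf ?mulr1.
have [|d dE] := IH (w - \sum_(i < n) chi i ((p ^ k.+1)%:R^-1 *~ c i)).
  rewrite mulrnBl cE -sumrMnl; apply/eqP; rewrite subr_eq0; apply/eqP.
  apply: eq_bigr => i _; rewrite !raddfMz -pE !raddfMn.
  by rewrite !pmulrn mulrzAC.
exists (fun i => c i + p%:Z * d i).
rewrite -[LHS](subrK (\sum_(i < n) chi i ((p ^ k.+1)%:R^-1 *~ c i))) dE -big_split.
apply: eq_bigr => i _; rewrite /= -raddfD; congr (chi i _).
rewrite mulrzDr addrC mulrzA -pmulrn; congr (_ + _ *~ _).
by rewrite expnSr natrM invfM -[RHS]mulr_natr divfK.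
Qed.

Lemma prufer_model (D : zmodType) : divisible D ->
  (forall d : D, exists2 m, (0 < m)%N & d *+ m = 0) ->
  (forall p, prime p -> finite_set (torsion_socle D p)) ->
  exists (n : nat -> nat) (h : (nat * nat -> rat) -> D),
    [/\ forall f1 f2, Dsub n f1 -> Dsub n f2 -> h (fun s => f1 s + f2 s) = h f1 + h f2,
        forall d, exists2 f, Dsub n f & h f = d
      & forall f, Dsub n f -> (h f = 0 <-> int_valued f)].
Proof.
move=> divD torsD fD.
have /choice[n /choice[x xP]] p : exists n (x : nat -> D), prime p ->
    [/\ forall i, x i *+ p = 0, independent p n x &
        forall v, v *+ p = 0 -> exists c, v = comb x n c].
  have [pp|] := boolP (prime p); last by exists 0%N, (fun=> 0).
  by have [n [x nx]] := socle_basis pp (fD p pp); exists n, x.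
have /choice[chi chiP] p : exists chi : nat -> {additive rat -> D}, prime p ->
    forall i, chi i p%:R^-1 = x p i.
  have [pp|] := boolP (prime p); last first.
    by have [z _] := @additive_of rat D (fun=> 0) (fun _ _ => esym (addr0 0)); exists (fun=> z).
  have /choice[chi chiE] i := rat_hom (x p i) divD (prime_gt0 pp).
  by exists chi.
(* [h] has to be defined on all functions, so a bound on the support is chosen for each; [hE] shows
   that on [Dsub n] any bound gives the same sum. *)
have /choice[bnd bndP] (f : nat * nat -> rat) : exists N, Dsub n f ->
    forall p i, f (p, i) != 0 -> (p < N)%N.
  have [[_ [[N NP] _]]|nd] := pselect (Dsub n f); first by exists N.
  by exists 0%N.
pose S (f : nat * nat -> rat) p := \sum_(i < n p) chi p i (f (p, i : nat)).
pose h (f : nat * nat -> rat) := \sum_(p < bnd f) S f p.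
have S0 f p : (forall i, f (p, i) = 0) -> S f p = 0.
  by move=> f0; rewrite /S big1 // => i _; rewrite f0 raddf0.
have hE f M : Dsub n f -> (forall p i, f (p, i) != 0 -> (p < M)%N) ->
    h f = \sum_(p < M) S f p.
  move=> Df fM; have trunc N : (forall p i, f (p, i) != 0 -> (p < N)%N) ->
      \sum_(p < N) S f p = \sum_(p < maxn N (maxn M (bnd f))) S f p.
    move=> fN; rewrite (big_ord_widen _ _ (leq_maxl N (maxn M (bnd f)))) big_mkcond /=.
    apply: eq_bigr => p _; case: ifPn => // pN; apply/esym/S0 => i.
    by apply/eqP; apply: contraNT pN => /fN.
  have mM : maxn M (maxn M (bnd f)) = maxn (bnd f) (maxn M (bnd f)) by lia.
  by rewrite /h [RHS]trunc // mM; apply: trunc; exact: bndP.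
have chi_int p i (z : int) : prime p -> chi p i z%:~R = 0.
  move=> pp; have p0 : (p%:R : rat) != 0 by rewrite pnatr_eq0 gtn_eqF ?prime_gt0.
  have -> : z%:~R = p%:R^-1 *+ p *~ z :> rat by rewrite -[_ *+ p]mulr_natr mulVf.
  by rewrite raddfMz raddfMn chiP //; case: (xP p pp) => ->; rewrite mul0rz.
have Snp f p : Dsub n f -> ~~ prime p -> S f p = 0.
  by move=> [sup _] np; apply: S0 => i; apply/eqP; apply: contraNT np => /sup[].
have Stors f p : Dsub n f -> exists k, S f p *+ p ^ k = 0.
  move=> Df; have [pp|/(Snp f p Df) ->] := boolP (prime p); last by exists 0%N.
  have [_ [_ /(_ p)/choice[k kP]]] := Df.
  exists (\sum_(i < n p) k i)%N; rewrite -sumrMnl big1 // => i _.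
  have [z zE] := kP i; rewrite -raddfMn (bigD1 i) //= expnD mulrnA -[f _ *+ _]mulr_natl zE.
  by rewrite raddfMn chi_int // mul0rn.
have hD f1 f2 : Dsub n f1 -> Dsub n f2 -> h (fun s => f1 s + f2 s) = h f1 + h f2.
  move=> D1 D2; have D12 := Dsub_add D1 D2.
  pose M := maxn (bnd f1) (maxn (bnd f2) (bnd (fun s => f1 s + f2 s))).
  rewrite !(hE _ M) // => [|p i /(bndP _ D2)|p i /(bndP _ D1)|p i /(bndP _ D12)];
    rewrite /M; try lia.
  rewrite -big_split; apply: eq_bigr => p _; rewrite -big_split; apply: eq_bigr => i _.
  by rewrite raddfD.
exists n, h; split=> //.
- pose Im d := exists2 f, Dsub n f & h f = d.
  have ImD d e : Im d -> Im e -> Im (d + e).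
    move=> [f Df <-] [g Dg <-]; exists (fun s => f s + g s); first exact: Dsub_add.
    exact: hD.
  have Imp p k w : prime p -> w *+ p ^ k = 0 -> Im w.
    move=> pp wk; have [_ _ span] := xP p pp.
    have [|c wE] := @prufer_onto D (chi p) p (n p) pp _ k w wk.
      move=> v /span[c ->]; exists c; apply: eq_comb => i _; by rewrite chiP.
    pose f (s : nat * nat) : rat :=
      if (s.1 == p) && (s.2 < n p)%N then (p ^ k)%:R^-1 *~ c s.2 else 0.
    have fp q i : f (q, i) != 0 -> q = p /\ (i < n p)%N.
      by rewrite /f /=; case: ifP => [/andP[/eqP -> ->]|_ /eqP].
    have pe0 : ((p ^ k)%:R : rat) != 0 by rewrite pnatr_eq0 -lt0n expn_gt0 prime_gt0.
    have Df : Dsub n f.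
      split; first by move=> q i /fp[-> ->].
      split; first by exists p.+1 => q i /fp[->].
      move=> q i; rewrite /f /=; case: ifP => [/andP[/eqP -> _]|_].
        by exists k, (c i); rewrite -mulrzr mulrA mulfV // mul1r.
      by exists 0%N, 0; rewrite mulr0.
    exists f => //; rewrite (hE f p.+1) //; last by move=> q i /fp[->].
    rewrite big_ord_recr big1 /= ?add0r => [|q _]; last first.
      apply: S0 => i; apply/eqP; apply: contraT => /fp[qp _].
      by have := ltn_ord q; rewrite qp ltnn.
    by rewrite /S wE; apply: eq_bigr => i _; rewrite /f /= eqxx ltn_ord.
  suff ImT m : (0 < m)%N -> forall d, d *+ m = 0 -> Im d.
    by move=> d; have [m m0 dm] := torsD d; exact: ImT m0 d dm.
  elim/ltn_ind: m => m IH m0 d dm.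
  have [m1|m1] := leqP m 1.
    have -> : d = 0 by rewrite -[d]mulr1n -dm; congr (_ *+ _); lia.
    by apply: (Imp 2%N 0%N); rewrite ?mul0rn.
  have pp := pdiv_prime m1; set p := pdiv m in pp.
  have [|u [v uv]] := @bezout_dvd (m`_p^')%N p (logn p m) pp.
    by rewrite dvdzE /= -prime_coprime // (@pnat_coprime p) ?pnat_id ?part_pnat.
  rewrite -p_part in uv; have mE := partnC p m0.
  rewrite -[d]mulr1z -uv mulrzDr; apply: ImD.
    apply: (Imp p (logn p m)) => //.
    by rewrite -p_part mulrC mulrzA -!pmulrn pmulrn mulrzAC -pmulrn -mulrnA mulnC mE dm mul0rz.
  apply: (IH m`_p^')%N.
  - rewrite -[ltnRHS]mE ltn_Pmull ?part_gt0 // p_part -[ltnLHS](expn0 p).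
    by rewrite ltn_exp2l ?prime_gt1 // logn_gt0 mem_primes pp m0 pdiv_dvd.
  - exact: part_gt0.
  - by rewrite mulrC mulrzA -!pmulrn pmulrn mulrzAC -pmulrn -mulrnA mE dm mul0rz.
- move=> f Df; split=> [h0|fint].
    have SP := primary_independence (S := S f) (fun p => @Snp f p Df) (fun p => Stors f p Df) h0.
    move=> [q i]; have [fqi|] := eqVneq (f (q, i)) 0; first by exists 0.
    have [sup [_ den]] := Df; move=> fqi; have [pq i_n] := sup _ _ fqi.
    have [xq ind _] := xP q pq.
    have /choice[k kP] := den q.
    have ind' : independent q (n q) (fun i => chi q i q%:R^-1).
      by move=> c c0; apply: ind; rewrite -c0; apply: eq_comb => j _; rewrite chiP.
    apply: (prufer_kernel pq ind' (t := \sum_(j < n q) k j) (f := fun j => f (q, j))) i_n.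
      move=> j jn; have [z zE] := kP j.
      rewrite (bigD1 (Ordinal jn)) //= addnC expnD natrM -mulrA zE.
      by eexists (_%:Z * z); rewrite intrM.
    by apply: SP; exact: bndP fqi.
  rewrite /h big1 // => p _; have [pp|] := boolP (prime p); last exact: Snp.
  by rewrite /S big1 // => i _; have [z ->] := fint (p : nat, i : nat); exact: chi_int.
Qed.

(** * Finite ranks and Extended Bassian groups *)

Lemma extended_bassian_of_finite_ranks (G : zmodType) :
  finite_ranks G -> extended_bassian G.
Proof.
move=> [rG fG].
have [D [i [iinj iD]]] := subgroup_zmod (divisible_torsion_subgroup G).
have Di d : divisible_torsion (i d) by apply/iD; exists d.
have divD : divisible D.
  move=> k d k0; have [y /iD[e <-] ey] := divisible_torsion_div fG k0 (Di d).
  by exists e; apply: iinj; rewrite raddfMn.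
have torsD (d : D) : exists2 m, (0 < m)%N & d *+ m = 0.
  have [[m m0 dm] _] := Di d; exists m => //.
  by apply: iinj; rewrite raddfMn dm raddf0.
have [n [h [hD honto hker]]] := prufer_model divD torsD
  (fun p pp => finite_socle_inj iinj (fG p pp)).
have [||r rP] := @divisible_extension G D [set z | exists d, z = (i d, d)] divD.
- split; first by exists 0; rewrite raddf0.
  by move=> _ _ [d ->] [e ->]; exists (d - e); rewrite raddfB.
- by move=> e [d [d0 ->]]; apply: iinj; rewrite -d0 raddf0.
have ri d : r (i d) = d by apply: rP; exists d.
have sker : subgroup [set g | r g = 0].
  by split=> [|x y rx ry] /=; rewrite ?raddf0 // raddfB rx ry subr0.
have [B [j [jinj jB]]] := subgroup_zmod sker.
have rj b : r (j b) = 0 by apply/jB; exists b.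
(* The image of such a [b] in [G] lies in [D], where [r] is the identity, and also in the kernel of
   [r]. *)
have reduced (b : B) : divisible_torsion b -> b = 0.
  move=> [[m m0 bm] bdiv]; have /iD[d db] : divisible_torsion (j b).
    split; first by exists m; rewrite // -raddfMn bm raddf0.
    by move=> k /bdiv[y <-]; exists (j y); rewrite raddfMn.
  by apply: jinj; rewrite raddf0 -db -(ri d) db rj raddf0.
exists B, n, (fun b f => j b + i (h f)); split.
  apply: bassian_criterion; first exact: finite_rank_inj jinj rG.
  by move=> p pp; apply: finite_primary_part => //; apply: finite_socle_inj jinj (fG p pp).
split; first by move=> b1 b2 f1 f2 D1 D2; rewrite hD // !raddfD addrACA.
split.
  move=> g; have [f Df fg] := honto (r g).
  have /jB[b bE] : r (g - i (r g)) = 0 by rewrite raddfB ri subrr.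
  by exists b, f; split=> //; rewrite fg bE subrK.
split=> [b f Df|f Df fint]; last by rewrite (hker f Df).2 // !raddf0 addr0.
move=> bf0; have hf0 : h f = 0.
  by have := congr1 r bf0; rewrite raddfD rj ri raddf0 add0r.
split; last exact/hker.
by apply: jinj; rewrite raddf0 -bf0 hf0 raddf0 addr0.
Qed.

Lemma Dsub_mulrn n f k : Dsub n f -> Dsub n (fun s => f s *+ k).
Proof.
move=> [sup [[N NP] den]]; split=> [p i|].
  by move=> fk; apply: sup; apply: contraNneq fk => ->; rewrite mul0rn.
split=> [|p i].
  by exists N => p i fk; apply: (NP p i); apply: contraNneq fk => ->; rewrite mul0rn.
by have [l [z zE]] := den p i; exists l, (z *+ k); rewrite mulrnAr zE rmorphMn.
Qed.

Lemma Dsub_sub n f1 f2 : Dsub n f1 -> Dsub n f2 -> Dsub n (fun s => f1 s - f2 s).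
Proof.
move=> D1 [sup [[N NP] den]]; apply: Dsub_add => //; split=> [p i|].
  by rewrite oppr_eq0; exact: sup.
split=> [|p i]; first by exists N => p i; rewrite oppr_eq0; exact: NP.
by have [k [z zE]] := den p i; exists k, (- z); rewrite mulrN zE intrN.
Qed.

Lemma Dsub_torsion n f : Dsub n f ->
  exists2 m, (0 < m)%N & int_valued (fun s => f s *+ m).
Proof.
move=> [sup [[N NP] _]].
exists (\prod_(p < N) \prod_(i < n p) `|denq (f (p : nat, i : nat))|)%N.
  by apply: prodn_gt0 => p; apply: prodn_gt0 => i; rewrite absz_gt0 denq_neq0.
move=> [p i]; have [->|fpi] := eqVneq (f (p, i)) 0; first by exists 0; rewrite mul0rn.
have [[_ i_n] pN] := (sup _ _ fpi, NP _ _ fpi).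
rewrite (bigD1 (Ordinal pN)) //= (bigD1 (Ordinal i_n)) //= -mulnA mulrnA.
set d := `|_|%N; set m := (_ * _)%N; exists (numq (f (p, i)) *+ m).
rewrite rmorphMn /= numqE -[f _ *+ d]mulr_natr; congr (_ * _ *+ _).
by rewrite pmulrn (gtz0_abs (denq_gt0 _)).
Qed.

(** The projection [rho] to [B] has torsion kernel, so it preserves independence over Z. If p kills
    [psi b f], then b is in the finite socle of [B], and f agrees modulo integers with one of the
    finitely many [g c], which take values c_i / p at the slots of p and 0 elsewhere. *)
Lemma finite_ranks_of_extended_bassian (G : zmodType) :
  extended_bassian G -> finite_ranks G.
Proof.
move=> [B [n [psi [/finite_ranks_of_bassian[rB fB] [psiD [psi_onto [psi_ker psi_int]]]]]]].
have D0 : Dsub n (fun=> 0).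
  split=> [p i|]; first by rewrite eqxx.
  by split=> [|p i]; [exists 0%N => p i; rewrite eqxx|exists 0%N, 0; rewrite mulr0].
have psi0 : psi 0 (fun=> 0) = 0 by apply: psi_int => // s; exists 0.
have psiMn b f k : Dsub n f -> psi b f *+ k = psi (b *+ k) (fun s => f s *+ k).
  move=> Df; elim: k => [|k IH].
    by rewrite !mulr0n -[LHS]psi0; congr (psi _ _); apply/funext => s; rewrite mulr0n.
  rewrite mulrS IH mulrS -psiD //; last exact: Dsub_mulrn.
  by congr (psi _ _); apply/funext => s; rewrite mulrS.
have psi_inj b f b' f' : Dsub n f -> Dsub n f' -> psi b f = psi b' f' -> b = b'.
  move=> Df Df' E; apply/eqP; rewrite -subr_eq0; apply/eqP.
  have := psi_ker (b - b') (fun s => f s - f' s) (Dsub_sub Df Df').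
  case=> //; apply: (addIr (psi b' f')); rewrite -psiD ?subrK ?add0r //; last exact: Dsub_sub.
  by rewrite -E; congr (psi _ _); apply/funext => s; rewrite subrK.
have /choice[b0 /choice[f0 bf]] := psi_onto.
have [g h|rho rhoE] := @additive_of G B b0.
  have [[Dg gE] [Dh hE]] := (bf g, bf h); have [Dgh ghE] := bf (g + h).
  apply: (psi_inj _ (f0 (g + h)) _ (fun s => f0 g s + f0 h s)) => //; first exact: Dsub_add.
  by rewrite psiD // gE hE ghE.
have rho_psi b f : Dsub n f -> rho (psi b f) = b.
  move=> Df; have [Dg gE] := bf (psi b f).
  by rewrite rhoE; apply: psi_inj gE.
split.
  have [r rBP] := rB; exists r => e ind; apply: (rBP (rho \o e)) => c.
  rewrite -raddf_comb => rc; have [f [Df]] : exists f, Dsub n f /\ psi 0 f = comb e r c.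
    by have [Dg gE] := bf (comb e r c); exists (f0 (comb e r c)); rewrite -[X in psi X _]rc rhoE.
  have [m m0 fm] := Dsub_torsion Df => fE i i_r.
  have := ind (fun j => c j * m%:Z); rewrite comb_mulz -fE -pmulrn psiMn // mul0rn.
  rewrite psi_int //; last exact: Dsub_mulrn.
  by move=> /(_ erefl i i_r); rewrite !dvd0z mulf_eq0 eqz_nat (gtn_eqF m0) orbF.
move=> p pp; have p0 : (p%:R : rat) != 0 by rewrite pnatr_eq0 gtn_eqF ?prime_gt0.
pose g (c : {ffun 'I_(n p) -> 'I_p}) (s : nat * nat) : rat :=
  if s.1 == p then if insub s.2 is Some i then (c i)%:R / p%:R else 0 else 0.
have Dg c : Dsub n (g c).
  have gnz q i : g c (q, i) != 0 -> q = p /\ (i < n p)%N.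
    rewrite /g /=; case: (q =P p) => [->|_]; last by rewrite eqxx.
    by case: insubP => [j -> _|]; rewrite ?eqxx.
  split; first by move=> q i /gnz[-> ->].
  split; first by exists p.+1 => q i /gnz[->].
  move=> q i; rewrite /g /=; case: eqP => [->|_]; last by exists 0%N, 0; rewrite mulr0.
  case: insubP => [j _ _|_]; last by exists 0%N, 0; rewrite mulr0.
  by exists 1%N, (c j : nat); rewrite expn1 mulrCA mulfV // mulr1.
have fing : finite_set (range (fun c => psi 0 (g c))) by apply: finite_image; exact: finite_finset.
apply: sub_finite_set (finite_image2 +%R (finite_image (fun b => psi b (fun=> 0)) (fB p pp)) fing).
move=> x xp; have [b [f [Df xE]]] := psi_onto x.
have xp0 : psi (b *+ p) (fun s => f s *+ p) = 0 by rewrite -psiMn // xE.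
have [bp fp] := psi_ker _ _ (Dsub_mulrn p Df) xp0.
exists (psi b (fun=> 0)); first by exists b.
have /choice[c cP] (i : 'I_(n p)) : exists k : 'I_p, exists w : int,
    f (p, i : nat) = k%:R / p%:R + w%:~R.
  have [z zE] := fp (p, i : nat).
  have pz : p%:Z != 0 by rewrite eqz_nat gtn_eqF ?prime_gt0.
  have zp : (`|(z %% p)%Z| < p)%N.
    by rewrite -ltz_nat gez0_abs ?modz_ge0 // ltz_pmod // ltz_nat prime_gt0.
  exists (Ordinal zp), (z %/ p)%Z; apply: (mulIf p0).
  rewrite mulr_natr zE /= mulrDl divfK // {1}(divz_eq z p) intrD intrM addrC.
  by congr (_ + _); rewrite pmulrn gez0_abs // modz_ge0.
exists (psi 0 (g [ffun i => c i])); first by eexists.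
have Dfg := Dsub_sub Df (Dg [ffun i => c i]).
have <- : psi 0 f = psi 0 (g [ffun i => c i]).
  have fE : f = (fun s => g [ffun i => c i] s + (f s - g [ffun i => c i] s)).
    by apply/funext => s; rewrite addrC subrK.
  rewrite {1}fE -{1}[0]addr0 psiD // [X in _ + X]psi_int ?addr0 //.
  move=> [q i]; rewrite /g /=; case: eqP => [->|/eqP qp].
    case: insubP => [j _ <-|].
      by have [w ->] := cP j; rewrite ffunE addrC addKr; exists w.
    move=> ni; rewrite subr0; have [->|] := eqVneq (f (p, i)) 0; first by exists 0.
    by case: Df => sup _ /sup[_]; rewrite (negPf ni).
  rewrite subr0; have [->|fqi] := eqVneq (f (q, i)) 0; first by exists 0.
  have [sup [_ den]] := Df; have [pq _] := sup _ _ fqi.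
  have [[k [z zE]] [w wE]] := (den q i, fp (q, i)).
  (* At a prime q other than p, both p f and q^k f are integral, hence so is f. *)
  have [|u [v uv]] := @bezout_dvd p q k pq.
    by rewrite dvdzE /= dvdn_prime2.
  exists (u * w + v * z); rewrite intrD !intrM -zE -wE -[f _ *+ p]mulr_natr.
  have uv' : u%:~R * p%:R + v%:~R * (q ^ k)%:R = 1 :> rat.
    by rewrite !pmulrn -!intrM -intrD uv.
  rewrite -[LHS]mulr1 -{1}uv' mulrDr mulrCA; congr (_ + _).
  by rewrite mulrCA [f _ * _]mulrC.
rewrite -psiD // -xE addr0; congr (psi _ _); apply/funext => s; exact: add0r.
Qed.

Theorem theorem5p8 :
  (forall X : gclass,
     iso_closed X ->
     subclass extended_bassian X ->
     subclass X directly_finite ->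
     forall G : zmodType, sclass X G <-> extended_bassian G) /\
  (forall G : zmodType, sclass directly_finite G <-> extended_bassian G).
Proof.
have main X : subclass extended_bassian X -> subclass X directly_finite ->
    forall G : zmodType, sclass X G <-> extended_bassian G.
  move=> EBX XDF G; split=> [[XG XK]|EBG].
    apply/extended_bassian_of_finite_ranks/finite_ranks_of_sdf.
    by split=> [|K f fsurj]; apply: XDF => //; apply: XK fsurj.
  split=> [|K f fsurj]; first exact: EBX.
  apply/EBX/extended_bassian_of_finite_ranks.
  exact: finite_ranks_quotient (finite_ranks_of_extended_bassian EBG) fsurj.
split=> [X _|]; first exact: main.
by apply: main => // G /finite_ranks_of_extended_bassian/finite_ranks_directly_finite.
Qed.
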